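(* Let $n\ge 3$ be an integer. (i) For any $a\in\mathbf{B}^n$ with $a\ne 0$, there exists a negative real number $\alpha_0\in(-n+2,0)$ such that, for any $\alpha\in(-n+2,\alpha_0]$, $$\int_{\mathbf{B}^n} r^{\alpha}\|\nabla u_0\|^2\,dx>\int_{\mathbf{B}^n} r^{\alpha}\|\nabla u_a\|^2\,dx .$$ (ii) For any integer $n\ge 6$, there exists $\alpha_0\in(4-n,5-n)$ such that, for any $\alpha\in(4-n,\alpha_0)$, there exists $a\in\mathbf{B}^n$ such that $$\int_{\mathbf{B}^n} r^{\alpha}\|\nabla u_0\|^2\,dx>\int_{\mathbf{B}^n} r^{\alpha}\|\nabla u_a\|^2\,dx .$$
   Context: $\mathbf{B}^n$ is the (open) Euclidean unit ball of $\mathbb{R}^n$, $\mathbb{S}^{n-1}$ its boundary sphere, $r=\|x\|$ the Euclidean norm of $x$, and $\|\nabla u\|=\big(\sum_{i,j}|\partial u_i/\partial x_j|^2\big)^{1/2}$. For $a\in\mathbf{B}^n$, the map $u_a:\mathbf{B}^n\setminus\{a\}\to\mathbb{S}^{n-1}$ is defined by $u_a(x)=a+\lambda_a(x)(x-a)$, where $\lambda_a(x)>0$ is chosen such that $u_a(x)\in\mathbb{S}^{n-1}$; that is, $u_a(x)$ is the intersection point of $\mathbb{S}^{n-1}$ with the half-line of origin $a$ passing through $x$. In particular $u_0(x)=\frac{x}{\|x\|}$. *)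

(* Defs.v *)
From HB Require Import structures.
From mathcomp Require Import all_boot all_order all_algebra.
From mathcomp Require Import all_classical all_reals all_analysis.
From mathcomp Require Import ring.

Set Implicit Arguments.
Unset Strict Implicit.
Unset Printing Implicit Defensive.

Import Order.TTheory GRing.Theory Num.Theory.
Import numFieldNormedType.Exports.

Local Open Scope classical_set_scope.
Local Open Scope ring_scope.

(* The n-fold product of a sigma-finite measure m on T, as a measure on n.-tuple T: the
   image of m \x m \x ... under (x, t) |-> x :: t. *)
Section product_measure_tuple.
Context d (T : measurableType d) (R : realType).

Definition cons_pair n (z : T * n.-tuple T) : n.+1.-tuple T :=
  [the n.+1.-tuple T of z.1 :: z.2].

Lemma measurable_cons_pair n : measurable_fun setT (@cons_pair n).
Proof. exact: (measurable_cons measurable_fst measurable_snd). Qed.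

Section step.
Context n (m : {sigma_finite_measure set T -> \bar R})
  (mu : {sigma_finite_measure set (n.-tuple T) -> \bar R}).

Definition product_measure_cons : set (n.+1.-tuple T) -> \bar R :=
  pushforward (m \x mu)%E (@cons_pair n).

Let cons0 : product_measure_cons set0 = 0%E.
Proof. by rewrite /product_measure_cons /pushforward preimage_set0 measure0. Qed.

Let cons_ge0 A : (0 <= product_measure_cons A)%E.
Proof. by rewrite /product_measure_cons /pushforward measure_ge0. Qed.

Let measurable_cons_preimage (A : set (n.+1.-tuple T)) :
  measurable A -> measurable (@cons_pair n @^-1` A).
Proof.
by move=> mA; rewrite -[X in measurable X]setTI; exact: measurable_cons_pair.
Qed.

Let cons_sigma_additive : semi_sigma_additive product_measure_cons.
Proof.
move=> F mF tF mUF; rewrite /product_measure_cons /pushforward preimage_bigcup.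
apply: measure_semi_sigma_additive.
- by move=> k; exact: measurable_cons_preimage.
- apply/trivIsetP => /= i j _ _ ij; rewrite -preimage_setI.
  by move/trivIsetP : tF => /(_ _ _ _ _ ij) ->//; rewrite preimage_set0.
- by rewrite -preimage_bigcup; exact: measurable_cons_preimage.
Qed.

HB.instance Definition _ := isMeasure.Build _ _ _
  product_measure_cons cons0 cons_ge0 cons_sigma_additive.

Let sigma_finite_cons : sigma_finite setT product_measure_cons.
Proof.
have /sigma_finiteP[F [FT ndF Foo]] := sigma_finiteT m.
have /sigma_finiteP[G [GT ndG Goo]] := sigma_finiteT mu.
pose uncons (t : n.+1.-tuple T) := (thead t, [tuple of behead t]).
have muncons : measurable_fun setT uncons.
  apply: measurable_fun_pair; first exact: measurable_tnth.
  exact: measurable_behead.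
have consK : cancel (@cons_pair n) uncons.
  by move=> [x t]; congr pair; exact/val_inj.
exists (fun k => uncons @^-1` (F k `*` G k)).
  apply/esym/seteqP; split => // t _.
  have [i _ Fi] : (\bigcup_k F k) (uncons t).1 by rewrite -FT.
  have [j _ Gj] : (\bigcup_k G k) (uncons t).2 by rewrite -GT.
  exists (maxn i j) => //; split.
  - by move: Fi; exact/subsetPset/ndF/leq_maxl.
  - by move: Gj; exact/subsetPset/ndG/leq_maxr.
move=> k; have [mF Fk] := Foo k; have [mG Gk] := Goo k; split.
  by rewrite -[X in measurable X]setTI; apply: muncons => //; exact: measurableX.
rewrite /product_measure_cons /pushforward.
rewrite -comp_preimage (_ : uncons \o _ = id); last exact/funext/consK.
rewrite preimage_id.
by rewrite product_measure1E// lte_mul_pinfty// ge0_fin_numE.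
Qed.

HB.instance Definition _ :=
  Measure_isSigmaFinite.Build _ _ _ product_measure_cons sigma_finite_cons.

End step.

Fixpoint product_measure_tuple (m : {sigma_finite_measure set T -> \bar R}) n :
    {sigma_finite_measure set (n.-tuple T) -> \bar R} :=
  match n with
  | 0 => \d_([tuple] : 0.-tuple T)
  | n'.+1 => product_measure_cons m (product_measure_tuple m n')
  end.

Lemma product_measure_tuple_box (m : {sigma_finite_measure set T -> \bar R}) n
    (A : 'I_n -> set T) : (forall i, measurable (A i)) ->
  product_measure_tuple m n [set t | forall i, A i (tnth t i)] =
  (\prod_(i < n) m (A i))%E.
Proof.
elim: n A => [|n IHn] A mA.
  rewrite big_ord0 /= diracE mem_set//=; by case.
rewrite big_ord_recl -IHn//= /product_measure_cons /pushforward.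
have mB : measurable [set t : n.-tuple T | forall i, A (lift ord0 i) (tnth t i)].
  rewrite (_ : mkset _ =
    \bigcap_(i in [set: 'I_n]) ((@tnth n T)^~ i @^-1` A (lift ord0 i))).
    apply: fin_bigcap_measurable => // i _.
    by rewrite -[X in measurable X]setTI; exact: measurable_tnth.
  by apply/seteqP; split => t /= tA i => [_|]; exact: tA.
rewrite -product_measure1E//; congr product_measure1.
apply/seteqP; split => -[x t] /=.
- move=> tA; split; first by have := tA ord0.
  by move=> i; have := tA (lift ord0 i); rewrite tnthS.
- move=> [x0 tA] i; have [j ->|->//] := unliftP ord0 i.
  by rewrite tnthS; exact: tA.
Qed.

End product_measure_tuple.

Definition lebesgue_measure_tuple (R : realType) (n : nat) :=
  product_measure_tuple (@lebesgue_measure R) n.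

Section euclidean.
Context {R : realType} {n : nat}.
Implicit Types (a x : 'rV[R]_n) (u : 'rV[R]_n -> 'rV[R]_n).

Definition row_of_tuple (t : n.-tuple (measurableTypeR R)) : 'rV[R]_n :=
  \row_i tnth t i.

Definition integral_rV (D : set 'rV[R]_n) (f : 'rV[R]_n -> \bar R) : \bar R :=
  (\int[lebesgue_measure_tuple R n]_(t in row_of_tuple @^-1` D)
    f (row_of_tuple t))%E.

(* The library's norm on 'rV[R]_n is the sup norm. *)
Definition enorm x : R := Num.sqrt (\sum_(i < n) x 0 i ^+ 2).

Definition unit_ball : set 'rV[R]_n := [set x | enorm x < 1].

Definition unit_sphere : set 'rV[R]_n := [set x | enorm x = 1].

(* Junk value 0 when no such l exists; for a in unit_ball and x <> a there is exactly
   one (ray_coefP, ray_coef_unique). *)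
Definition ray_coef a x : R :=
  xget 0 [set l : R | 0 < l /\ unit_sphere (a + l *: (x - a))].

Definition ray_proj a x : 'rV[R]_n := a + ray_coef a x *: (x - a).

Definition partial_derivative u (i j : 'I_n) x : R :=
  'D_(delta_mx 0 j) (fun y : 'rV[R]_n => u y 0 i) x.

Definition grad_norm u x : R :=
  Num.sqrt (\sum_(i < n) \sum_(j < n) `|partial_derivative u i j x| ^+ 2).

Definition weighted_energy (alpha : R) u : \bar R :=
  integral_rV unit_ball (fun x => (enorm x `^ alpha * grad_norm u x ^+ 2)%:E).

Let sqn x := \sum_(i < n) x 0 i ^+ 2.

Let sqn_ge0 x : 0 <= sqn x.
Proof. by apply: sumr_ge0 => i _; exact: sqr_ge0. Qed.

Let enorm_sqn x : enorm x ^+ 2 = sqn x.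
Proof. by rewrite /enorm sqr_sqrtr//; exact: sqn_ge0. Qed.

Let sqn_ray a v (l : R) : sqn (a + l *: v) =
  sqn a + 2 * l * (\sum_(i < n) a 0 i * v 0 i) + l ^+ 2 * sqn v.
Proof.
rewrite /sqn !mulr_sumr -!big_split/=; apply: eq_bigr => i _.
by rewrite !mxE; ring.
Qed.

Let sphereE x : unit_sphere x <-> sqn x = 1.
Proof.
rewrite /unit_sphere /= -enorm_sqn; split => [->|x1]; first by rewrite expr1n.
by apply/eqP; rewrite -sqrp_eq1 ?sqrtr_ge0 ?x1.
Qed.

Let sqn_lt1 a : unit_ball a -> sqn a < 1.
Proof. by rewrite /unit_ball /= -enorm_sqn => a1; rewrite expr_lt1 ?sqrtr_ge0. Qed.

Let sqn_gt0 x : x != 0 -> 0 < sqn x.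
Proof.
move=> x0; rewrite lt0r sqn_ge0 andbT; apply: contra x0 => /eqP x0.
apply/eqP/rowP => i; rewrite mxE; apply/eqP; rewrite -sqrf_eq0.
by move: x0 => /psumr_eq0P -> // j _; exact: sqr_ge0.
Qed.

Lemma ray_coefP a x : unit_ball a -> x != a ->
  0 < ray_coef a x /\ unit_sphere (ray_proj a x).
Proof.
move=> /sqn_lt1 a1 xa; rewrite /ray_proj /ray_coef.
set P := [set l : R | _]; suff : exists l, P l by exact: xgetPex.
have q0 : 0 < sqn (x - a) by rewrite sqn_gt0// subr_eq0.
set p := \sum_(i < n) a 0 i * (x - a) 0 i.
pose D := p ^+ 2 + sqn (x - a) * (1 - sqn a).
have pD : p ^+ 2 < D by rewrite ltrDl mulr_gt0// subr_gt0.
have D0 : 0 <= D by rewrite (le_trans (sqr_ge0 p))// ltW.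
exists ((Num.sqrt D - p) / sqn (x - a)); split.
  rewrite divr_gt0// subr_gt0 (le_lt_trans (ler_norm _))//.
  by rewrite -sqrtr_sqr ltr_sqrt// (le_lt_trans (sqr_ge0 p)).
apply/sphereE; rewrite sqn_ray -/p.
have := sqr_sqrtr D0; rewrite [in X in _ = X]/D; set s := Num.sqrt D => sE.
apply/eqP; rewrite -subr_eq0; apply/eqP.
transitivity ((s ^+ 2 - (p ^+ 2 + sqn (x - a) * (1 - sqn a))) / sqn (x - a)).
  by field; rewrite gt_eqF.
by rewrite sE subrr mul0r.
Qed.

Lemma ray_coef_unique a x (l : R) : unit_ball a -> x != a ->
  0 < l -> unit_sphere (a + l *: (x - a)) -> l = ray_coef a x.
Proof.
move=> a1 xa l0 /sphereE; rewrite sqn_ray => lE.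
have [k0 /sphereE] := ray_coefP a1 xa; rewrite sqn_ray => kE.
move/sqn_lt1 : a1 => a1; have q0 : 0 < sqn (x - a) by rewrite sqn_gt0// subr_eq0.
set k := ray_coef a x in k0 kE *; set p := \sum_(i < n) _ in lE kE.
set q := sqn (x - a) in q0 lE kE; set b := sqn a in a1 lE kE.
have : (l - k) * (q * l * k + (1 - b)) = 0.
  transitivity ((b + 2 * l * p + l ^+ 2 * q - 1) * k
     - (b + 2 * k * p + k ^+ 2 * q - 1) * l); first by ring.
  by rewrite lE kE subrr !mul0r subrr.
move/eqP; rewrite mulf_eq0 subr_eq0 => /orP[/eqP//|].
by rewrite gt_eqF// addr_gt0 ?mulr_gt0// subr_gt0.
Qed.

End euclidean.

(* Main.v *)
Require Import Defs.
From mathcomp Require Import all_boot all_order all_algebra.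
From mathcomp Require Import all_classical all_reals all_analysis.
From mathcomp Require Import measurable_realfun zify ring lra.

Import Order.TTheory GRing.Theory Num.Theory.
Import numFieldNormedType.Exports.

Set Implicit Arguments.
Unset Strict Implicit.
Unset Printing Implicit Defensive.

Local Open Scope classical_set_scope.
Local Open Scope ring_scope.

(** The density of the energy is explicit: with [y = x - a], [u = ray_proj a]
    and [l = ray_coef a x], the Jacobian of [u] has the entries
    [l (delta_ij - y_i u_j / sqrt D)], where [D] is a quarter of the
    discriminant of the quadratic equation that defines [l]; hence
    [|grad u|^2 = l^2 (n - 2 + |y|^2 / D)] ([grad_norm_ray_proj]). For [a = 0]
    this is [(n - 1) / |x|^2], and in general it is of order [|x - a|^-2].

    Both parts reduce to the left end [beta] of the interval of exponents
    ([beta = 2 - n] and [beta = 4 - n]). As [alpha] decreases to [beta], the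
    weight [r^alpha] increases to [r^beta]; so the energy of [ray_proj a] at
    [alpha] is at most its energy at [beta], while the energy of [ray_proj 0]
    converges to its value at [beta] by monotone convergence. A strict
    inequality at [beta] therefore persists to the right of [beta]
    ([weighted_energy_center_lsc]).

    For (i), the energy of [ray_proj 0] at [2 - n] is a multiple of the
    divergent integral of [|x|^-n], whereas that of [ray_proj a] is finite: the
    singularities [|x|^(2 - n)] and [|x - a|^-2] of its integrand sit at
    different points.

    For (ii), the energy at [4 - n] is averaged over the [2 n] points
    [a = +- delta e_i]. Using [l <= (1 - a.y / |y|) / |y|], the density for [a]
    is at most [(n - 1) (|y|^-2 - 2 a.y |y|^-3)] up to an error of order
    [delta^2 |y|^-2]. The terms in [a.y] nearly cancel between [a] and [- a]
    ([first_order_bound_pair]). Since [|x|^-2] is superharmonic for n > 4, the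
    mean of [|x - a|^-2] lies below [|x|^-2] by a multiple of
    [delta^2 |x|^-4] for [|x| >= 5 delta] ([sum_inv_sqr_shift]). Multiplied by
    the weight [|x|^(4 - n)], this gain becomes [delta^2 |x|^-n], whose integral
    is [delta^2] times a quantity that diverges as [delta] tends to 0, while
    all errors, including the whole contribution of [|x| < 5 delta], integrate
    to [O(delta^2)]. Hence some [a = +- delta e_i] has lower energy than 0
    ([exists_lower_energy]).

    The integrals of powers of a distance are estimated by cubes alone: dyadic
    shells are covered by cubes for the upper bounds
    ([integral_sing_kernel_le]), and disjoint cubes of dyadic sides give the
    divergence ([integral_annulus_kernel_unbounded]). *)

(** * The Euclidean norm and the gradient of the ray projection *)

Section Calculus.
Context {R : realType} {n : nat}.
Implicit Types (a x y : 'rV[R]_n).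

Definition dotv a x : R := \sum_(i < n) a 0 i * x 0 i.

Lemma dotvC a x : dotv a x = dotv x a.
Proof. by apply: eq_bigr => i _; rewrite mulrC. Qed.

Lemma dotvDr a x y : dotv a (x + y) = dotv a x + dotv a y.
Proof. by rewrite -big_split; apply: eq_bigr => i _; rewrite mxE mulrDr. Qed.

Lemma dotvZr a (k : R) x : dotv a (k *: x) = k * dotv a x.
Proof. by rewrite /dotv mulr_sumr; apply: eq_bigr => i _; rewrite mxE; ring. Qed.

Lemma dotvBr a x y : dotv a (x - y) = dotv a x - dotv a y.
Proof. by rewrite dotvDr -scaleN1r dotvZr mulN1r. Qed.

Lemma dotv_delta a (j : 'I_n) : dotv a (delta_mx 0 j) = a 0 j.
Proof.
rewrite /dotv (bigD1 j)//= mxE !eqxx mulr1 big1 ?addr0// => i ij.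
by rewrite mxE (negbTE ij) andbF mulr0.
Qed.

Lemma dotvv_line x y (h : R) :
  dotv (x + h *: y) (x + h *: y) = dotv x x + 2 * h * dotv x y + h ^+ 2 * dotv y y.
Proof.
rewrite dotvDr dotvZr (dotvC _ x) (dotvC _ y) !dotvDr !dotvZr (dotvC y x); ring.
Qed.

Lemma dotvv_ge0 x : 0 <= dotv x x.
Proof. by apply: sumr_ge0 => i _; rewrite -expr2 sqr_ge0. Qed.

Lemma enorm_sqr x : enorm x ^+ 2 = dotv x x.
Proof.
rewrite /enorm sqr_sqrtr; last by apply: sumr_ge0 => i _; exact: sqr_ge0.
by apply: eq_bigr => i _; rewrite expr2.
Qed.

Lemma enorm_ge0 x : 0 <= enorm x.
Proof. exact: sqrtr_ge0. Qed.

Lemma enormE x : enorm x = Num.sqrt (dotv x x).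
Proof. by congr Num.sqrt; apply: eq_bigr => i _; rewrite expr2. Qed.

Lemma dotvv_eq0 x : (dotv x x == 0) = (x == 0).
Proof.
apply/eqP/eqP => [/psumr_eq0P x0|->]; last first.
  by apply: big1 => i _; rewrite mxE mul0r.
apply/rowP => i; rewrite mxE; apply/eqP; rewrite -sqrf_eq0 expr2 x0//.
by move=> j _; rewrite -expr2 sqr_ge0.
Qed.

Lemma enorm_eq0 x : (enorm x == 0) = (x == 0).
Proof. by rewrite -(sqrf_eq0 (enorm x)) enorm_sqr dotvv_eq0. Qed.

Lemma enorm_gt0 x : (0 < enorm x) = (x != 0).
Proof. by rewrite lt0r enorm_eq0 enorm_ge0 andbT. Qed.

Lemma dotvv_gt0 x : (0 < dotv x x) = (x != 0).
Proof. by rewrite lt0r dotvv_eq0 dotvv_ge0 andbT. Qed.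

Lemma enorm_coord_le x (i : 'I_n) : `|x 0 i| <= enorm x.
Proof.
rewrite -sqrtr_sqr enormE ler_wsqrtr// /dotv (bigD1 i)//= -expr2 lerDl.
by apply: sumr_ge0 => j _; rewrite -expr2 sqr_ge0.
Qed.

(** Expand [|a - (a.x / |x|^2) x|^2 >= 0]. *)
Lemma cauchy_schwarz a x : dotv a x ^+ 2 <= dotv a a * dotv x x.
Proof.
have [->|x0] := eqVneq x 0.
  have d0 b : dotv b 0 = 0 by apply: big1 => i _; rewrite mxE mulr0.
  by rewrite !d0 expr0n mulr0.
have q0 : 0 < dotv x x by rewrite dotvv_gt0.
have := dotvv_ge0 (a + (- (dotv a x / dotv x x)) *: x).
rewrite dotvv_line => h.
rewrite -subr_ge0.
suff -> : dotv a a * dotv x x - dotv a x ^+ 2 =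
  dotv x x * (dotv a a + 2 * - (dotv a x / dotv x x) * dotv a x
   + (- (dotv a x / dotv x x)) ^+ 2 * dotv x x) by exact: mulr_ge0 (ltW q0) h.
by field; rewrite gt_eqF.
Qed.

(** A quarter of the discriminant of the equation [|a + l (x - a)|^2 = 1] in
    [l]. *)
Definition ray_disc a x : R :=
  dotv a (x - a) ^+ 2 + dotv (x - a) (x - a) * (1 - dotv a a).

Lemma unit_ball_sqr a : unit_ball a <-> dotv a a < 1.
Proof.
rewrite /unit_ball /= -enorm_sqr; split => h; first by rewrite expr_lt1 ?enorm_ge0.
by move: h; rewrite expr_lt1 ?enorm_ge0.
Qed.

Lemma unit_sphere_sqr a : unit_sphere a <-> dotv a a = 1.
Proof.
rewrite /unit_sphere /= -enorm_sqr; split => [->|/eqP]; first by rewrite expr1n.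
by rewrite sqrp_eq1 ?enorm_ge0 // => /eqP.
Qed.

Lemma ray_disc_gt0 a x : unit_ball a -> x != a -> 0 < ray_disc a x.
Proof.
move=> /unit_ball_sqr a1 xa; apply: ltr_wpDl; first exact: sqr_ge0.
by rewrite mulr_gt0 ?subr_gt0// dotvv_gt0 subr_eq0.
Qed.

(** At [x = a] both sides are the default value 0, so the closed form
    holds on the whole space and may be differentiated as a function. *)
Lemma ray_coefE a x : unit_ball a ->
  ray_coef a x = (Num.sqrt (ray_disc a x) - dotv a (x - a)) / dotv (x - a) (x - a).
Proof.
move=> a1; have [->|xa] := eqVneq x a.
  rewrite subrr.
  have -> : dotv (0 : 'rV[R]_n) 0 = 0 by apply/eqP; rewrite dotvv_eq0.
  rewrite invr0 mulr0 /ray_coef; case: xgetP => // l _ [_].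
  rewrite subrr scaler0 addr0 /unit_sphere /= => aE.
  by move: a1; rewrite /unit_ball /= aE ltxx.
have D0 := ray_disc_gt0 a1 xa; have q0 : 0 < dotv (x - a) (x - a).
  by rewrite dotvv_gt0 subr_eq0.
apply: esym; apply: ray_coef_unique => //.
  rewrite divr_gt0// subr_gt0 (le_lt_trans (ler_norm _))// -sqrtr_sqr ltr_sqrt//.
  rewrite ltrDl mulr_gt0// subr_gt0; exact/unit_ball_sqr.
apply/unit_sphere_sqr; rewrite dotvv_line.
have := sqr_sqrtr (ltW D0); set s := Num.sqrt _.
rewrite /ray_disc; set p := dotv a (x - a); set q := dotv (x - a) _ => sE.
apply/eqP; rewrite -subr_eq0; apply/eqP.
transitivity ((s ^+ 2 - (p ^+ 2 + q * (1 - dotv a a))) / q).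
  by field; rewrite gt_eqF.
by rewrite sE subrr mul0r.
Qed.

(** Partial derivatives thus become derivatives of functions of one real
    variable, to which the chain rule for [Num.sqrt] applies. *)
Lemma derive_line (f : 'rV[R]_n -> R) x v :
  'D_v f x = 'D_1 (fun h : R => f (x + h *: v)) 0.
Proof.
rewrite /derive; set F := (X in fmap X _); set G := (X in _ = lim (fmap X _)).
suff -> : F = G by [].
apply/funext => h; rewrite /F /G /= scale0r !addr0 /GRing.scale /= mulr1.
by rewrite (addrC x).
Qed.

Lemma is_derive_quadratic (c0 c1 c2 : R) :
  is_derive (0 : R) 1 (fun h : R => c0 + c1 * h + c2 * h ^+ 2) c1.
Proof.
have -> : (fun h : R => c0 + c1 * h + c2 * h ^+ 2) =
    cst c0 + c1 *: (@idfun R) + c2 *: ((@idfun R) ^+ 2).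
  by apply/funext => h.
have d0 := is_derive_cst c0 (0 : R) 1.
have d1 := is_deriveZ c1 (is_derive_id (0 : R) 1).
have d2 := is_deriveZ c2 (is_deriveX 2 (is_derive_id (0 : R) 1)).
apply: (is_derive_eq (is_deriveD (is_deriveD d0 d1) d2)).
by rewrite /GRing.scale /= expr1 mulr0 mul0r mulr0 mulr1 addr0 add0r.
Qed.

(** Along a line, the data [p], [q] and [D] of the equation that defines
    [ray_coef] are polynomials of degree at most 2 in the parameter. The value
    of the derivative is the one obtained by differentiating
    [l q + p = sqrt D]. *)
Lemma is_derive_quadratic_root (p p1 q q1 q2 D D1 D2 : R) : 0 < q -> 0 < D ->
  let s := Num.sqrt D in
  let l := (s - p) / q in
  is_derive (0 : R) 1 (fun h : R =>
    (Num.sqrt (D + D1 * h + D2 * h ^+ 2) - (p + p1 * h)) /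
    (q + q1 * h + q2 * h ^+ 2))
   ((D1 / (2 * s) - p1 - l * q1) / q).
Proof.
move=> q0 D0 s l.
pose Q := fun h : R => q + q1 * h + q2 * h ^+ 2.
pose P := fun h : R => p + p1 * h.
pose E := fun h : R => D + D1 * h + D2 * h ^+ 2.
have dQ : is_derive (0 : R) 1 Q q1 by exact: is_derive_quadratic.
have dP : is_derive (0 : R) 1 P p1.
  have -> : P = fun h => p + p1 * h + 0 * h ^+ 2.
    by apply/funext => h; rewrite /P mul0r addr0.
  exact: is_derive_quadratic.
have dE : is_derive (0 : R) 1 E D1 by exact: is_derive_quadratic.
have Q0 : Q 0 = q by rewrite /Q !mulr0 expr0n /= mulr0 !addr0.
have E0 : E 0 = D by rewrite /E !mulr0 expr0n /= mulr0 !addr0.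
have P0 : P 0 = p by rewrite /P mulr0 addr0.
have dS : is_derive (0 : R) 1 (Num.sqrt \o E) ((2 * s)^-1 * D1).
  apply: is_derive1_comp; rewrite E0; exact: is_derive1_sqrt.
have dI : is_derive (0 : R) 1 (fun h => (Q h)^-1) (- q ^- 2 * q1).
  have Qn : Q 0 != 0 by rewrite Q0 gt_eqF.
  have dvQ : derivable Q 0 1 by case: dQ.
  apply: DeriveDef; first exact: derivableV.
  by rewrite deriveV// Q0 derive_val.
have -> : (fun h : R => (Num.sqrt (D + D1 * h + D2 * h ^+ 2) - (p + p1 * h)) /
    (q + q1 * h + q2 * h ^+ 2)) = ((Num.sqrt \o E) - P) * (fun h => (Q h)^-1).
  by apply/funext.
apply: (is_derive_eq (is_deriveM (is_deriveB dS dP) dI)).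
rewrite /GRing.scale /= !fctE /= E0 P0 Q0 -/s /l.
have s0 : 0 < s by rewrite sqrtr_gt0.
by field; rewrite !gt_eqF.
Qed.

(** Differentiating [|u|^2 = 1] for [u = a + l y] gives
    [d_j l = - l u_j / sqrt D], because the scalar product of [y] and [u] is
    [l q + p = sqrt D]. *)
Lemma partial_derivative_ray_proj a x (i j : 'I_n) : unit_ball a -> x != a ->
  partial_derivative (ray_proj a) i j x =
  ray_coef a x * ((i == j)%:R -
    (x - a) 0 i * ray_proj a x 0 j / Num.sqrt (ray_disc a x)).
Proof.
move=> a1 xa; rewrite /partial_derivative derive_line.
set y := x - a; set p := dotv a y; set q := dotv y y.
have q0 : 0 < q by rewrite dotvv_gt0 subr_eq0.
have D0 := ray_disc_gt0 a1 xa.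
set l := ray_coef a x; set s := Num.sqrt _.
have lE : l = (s - p) / q by exact: ray_coefE.
have s0 : 0 < s by rewrite sqrtr_gt0.
pose c := 1 - dotv a a.
pose L := fun h : R =>
    (Num.sqrt (ray_disc a x + (2 * p * a 0 j + 2 * y 0 j * c) * h
        + (a 0 j ^+ 2 + c) * h ^+ 2) - (p + a 0 j * h)) /
    (q + (2 * y 0 j) * h + 1 * h ^+ 2).
have -> : (fun h : R => ray_proj a (x + h *: delta_mx 0 j) 0 i) =
    cst (a 0 i) + L * (fun h : R => y 0 i + (i == j)%:R * h + 0 * h ^+ 2).
  apply/funext => h; rewrite /ray_proj ray_coefE// /ray_disc.
  have -> : x + h *: delta_mx 0 j - a = y + h *: delta_mx 0 j.
    by rewrite /y addrAC.
  rewrite dotvv_line (dotvDr a) dotvZr !dotv_delta !fctE /= /L.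
  rewrite !mxE eqxx eqxx /= /ray_disc -/y -/p -/q -/c.
  f_equal; f_equal; last by ring.
  f_equal; last by congr (_^-1); ring.
  by f_equal; [congr Num.sqrt|congr (- _)]; ring.
have dL : is_derive (0 : R) 1 L
   (((2 * p * a 0 j + 2 * y 0 j * c) / (2 * s) - a 0 j - l * (2 * y 0 j)) / q).
  rewrite lE; exact: is_derive_quadratic_root.
have dY := is_derive_quadratic (y 0 i) (i == j)%:R 0.
have L0 : L 0 = l by rewrite lE /L !mulr0 expr0n /= !mulr0 !addr0.
have dLY := is_deriveD (is_derive_cst (a 0 i) (0 : R) 1) (is_deriveM dL dY).
rewrite (@derive_val _ _ _ _ _ _ _ dLY) /GRing.scale /= L0.
rewrite !mulr0 expr0n /= mulr0 !addr0 add0r.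
have sq : s = l * q + p by rewrite lE divfK ?gt_eqF// subrK.
have cE : c = l ^+ 2 * q + 2 * l * p.
  have sc : s ^+ 2 = p ^+ 2 + q * c by rewrite sqr_sqrtr ?(ltW D0).
  have : q * c = q * (l ^+ 2 * q + 2 * l * p).
    have -> : q * c = s ^+ 2 - p ^+ 2 by rewrite sc; ring.
    by rewrite sq; ring.
  by move/mulfI; apply; rewrite gt_eqF.
have -> : ray_proj a x 0 j = a 0 j + l * y 0 j by rewrite /ray_proj !mxE.
rewrite cE; move: s0; rewrite sq => s0.
by field; rewrite !gt_eqF.
Qed.

(** Since [u = ray_proj a x] lies on the sphere and makes with [y = x - a]
    the scalar product [sqrt D], the squares of the entries
    [l (delta_ij - y_i u_j / sqrt D)] of the Jacobian add up to
    [l^2 (n - 2 + |y|^2 / D)]. *)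
Lemma grad_norm_ray_proj a x : unit_ball a -> x != a ->
  grad_norm (ray_proj a) x ^+ 2 =
  ray_coef a x ^+ 2 * (n%:R - 2 + dotv (x - a) (x - a) / ray_disc a x).
Proof.
move=> a1 xa; rewrite /grad_norm sqr_sqrtr; last first.
  by do 2!(apply: sumr_ge0 => ? _); exact: sqr_ge0.
set l := ray_coef a x; set y := x - a; set u := ray_proj a x.
have D0 := ray_disc_gt0 a1 xa.
set s := Num.sqrt (ray_disc a x).
have s0 : 0 < s by rewrite sqrtr_gt0.
have q0 : 0 < dotv y y by rewrite dotvv_gt0 subr_eq0.
have uu : dotv u u = 1.
  by apply/unit_sphere_sqr; have [] := ray_coefP a1 xa.
have yu : dotv y u = s.
  rewrite /u /ray_proj dotvDr dotvZr ray_coefE// -/y (dotvC y a) divfK ?gt_eqF//.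
  by rewrite addrC subrK.
have row i : \sum_(j < n) `|partial_derivative (ray_proj a) i j x| ^+ 2 =
    l ^+ 2 * (1 - 2 * (y 0 i * u 0 i) / s + y 0 i ^+ 2 / s ^+ 2).
  transitivity (\sum_(j < n) l ^+ 2 * ((i == j)%:R
      - 2 * (y 0 i / s) * ((i == j)%:R * u 0 j)
      + (y 0 i / s) ^+ 2 * (u 0 j * u 0 j))).
    apply: eq_bigr => j _; rewrite partial_derivative_ray_proj// real_normK ?num_real//.
    rewrite -/l -/y -/u -/s.
    by case: (i == j) => /=; ring.
  have sd (f : 'I_n -> R) : \sum_j (i == j)%:R * f j = f i.
    rewrite (bigD1 i)//= eqxx mul1r big1 ?addr0// => j ij.
    by rewrite eq_sym (negbTE ij) mul0r.
  rewrite -mulr_sumr !big_split /= sumrN -!mulr_sumr sd -/(dotv u u) uu.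
  have -> : \sum_(j < n) ((i == j)%:R : R) = 1.
    by rewrite -[RHS](sd (fun=> 1)); apply: eq_bigr => j _; rewrite mulr1.
  by rewrite mulr1; field; rewrite gt_eqF.
rewrite (eq_bigr _ (fun i _ => row i)) -mulr_sumr; congr (_ * _).
rewrite !big_split /= sumrN sumr_const card_ord -!mulr_suml -!mulr_sumr.
rewrite -/(dotv y u) yu.
have -> : \sum_(i < n) y 0 i ^+ 2 = dotv y y.
  by apply: eq_bigr => i _; rewrite expr2.
rewrite sqr_sqrtr ?(ltW D0)//.
by field; rewrite !gt_eqF.
Qed.
End Calculus.

(** * Integrals of powers of the distance to a point *)

Section SingularKernel.
Context {R : realType} {n : nat}.
Implicit Types (a : 'rV[R]_n) (t : n.-tuple (measurableTypeR R)).

Local Notation mu := (lebesgue_measure_tuple R n).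

Definition dist_tuple a t : R := enorm (row_of_tuple t - a).

Lemma dist_tuple_ge0 a t : 0 <= dist_tuple a t.
Proof. exact: enorm_ge0. Qed.

Lemma measurable_coord (i : 'I_n) :
  measurable_fun setT (fun t : n.-tuple (measurableTypeR R) => row_of_tuple t 0 i : R).
Proof.
rewrite (_ : (fun _ => _) = fun t => tnth t i); first exact: measurable_tnth.
by apply/funext => t; rewrite mxE.
Qed.

Lemma measurable_dist_tuple a : measurable_fun setT (dist_tuple a : _ -> R).
Proof.
have -> : dist_tuple a =
    fun t => (\sum_(i < n) (row_of_tuple t 0 i - a 0 i) ^+ 2) `^ 2^-1.
  apply/funext => t; rewrite powR12_sqrt; last first.
    by apply: sumr_ge0 => i _; exact: sqr_ge0.
  by rewrite /dist_tuple /enorm; congr Num.sqrt; apply: eq_bigr => i _; rewrite !mxE.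
apply: (measurableT_comp (measurable_powR _)).
apply: measurable_sum => i; apply: measurable_funX.
by apply: measurable_funB => //; exact: measurable_coord.
Qed.

Lemma measurable_dist_expVn a m :
  measurable_fun setT (fun t => dist_tuple a t ^- m : R).
Proof.
have -> : (fun t => dist_tuple a t ^- m) = fun t => dist_tuple a t `^ (- m%:R).
  by apply/funext => t; rewrite powR_invn ?dist_tuple_ge0.
exact: (measurableT_comp (measurable_powR _)) (measurable_dist_tuple a).
Qed.

Definition box (l u : 'I_n -> R) : set (n.-tuple (measurableTypeR R)) :=
  [set t | forall i, `]l i, u i]%classic (tnth t i)].

Lemma measurable_box l u : measurable (box l u).
Proof.
rewrite (_ : box l u = \bigcap_(i in [set: 'I_n])
    ((@tnth n (measurableTypeR R))^~ i @^-1` `]l i, u i]%classic)).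
  apply: fin_bigcap_measurable => // i _.
  by rewrite -[X in measurable X]setTI; apply: measurable_tnth.
by apply/seteqP; split => t /= tA i => [_|]; exact: tA.
Qed.

Lemma box_measure l u : (forall i, l i <= u i) ->
  mu (box l u) = (\prod_(i < n) (u i - l i))%:E.
Proof.
move=> lu; have mI i : measurable (`]l i, u i]%classic : set (measurableTypeR R)).
  exact: measurable_itv.
rewrite (product_measure_tuple_box (@lebesgue_measure R) mI).
rewrite -prodEFin; apply: eq_bigr => i _.
transitivity (lebesgue_measure (`]l i, u i]%classic : set R)) => //.
rewrite lebesgue_measure_itv /= lte_fin; case: ltP => // ul.
by rewrite (_ : u i = l i) ?subrr//; apply/eqP; rewrite eq_le ul lu.
Qed.

Lemma cube_measure (c : 'I_n -> R) (r : R) : 0 <= r ->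
  mu (box c (fun i => c i + r)) = (r ^+ n)%:E.
Proof.
move=> r0; rewrite box_measure => [|i]; last by rewrite lerDl.
congr EFin; rewrite (eq_bigr (fun=> r)) => [|i _]; last by rewrite addrC addKr.
by rewrite prodr_const card_ord.
Qed.

Definition sing_kernel a m (rho : R) t : R :=
  if dist_tuple a t < rho then dist_tuple a t ^- m else 0.

Lemma sing_kernel_ge0 a m rho t : 0 <= sing_kernel a m rho t.
Proof.
rewrite /sing_kernel; case: ifP => // _.
by rewrite invr_ge0 exprn_ge0 ?dist_tuple_ge0.
Qed.

Lemma measurable_sing_kernel a m rho :
  measurable_fun setT (sing_kernel a m rho : _ -> R).
Proof.
apply: measurable_fun_ifT => //; last exact: measurable_dist_expVn.
by apply: measurable_fun_ltr => //; exact: measurable_dist_tuple.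
Qed.

Lemma dyadic_scale (rho d : R) : 0 < d -> d < rho ->
  exists j : nat, rho / 2 ^+ j.+1 <= d /\ d < rho / 2 ^+ j.
Proof.
move=> d0 dr; have r0 : 0 < rho by exact: lt_trans dr.
have ex : exists j, rho / 2 ^+ j.+1 <= d.
  exists (Num.truncn (rho / d)); rewrite ler_pdivrMr ?exprn_gt0//.
  rewrite mulrC -ler_pdivrMr// (le_trans (ltW (truncnS_gt _)))//.
  by rewrite -natrX ler_nat ltnW// ltn_expl.
case: (ex_minnP ex) => j jd jmin; exists j; split => //.
case: j jd jmin => [|j] jd jmin; first by rewrite expr0 divr1.
by rewrite ltNge; apply/negP => /jmin; rewrite ltnn.
Qed.

(** On the dyadic shell [rho / 2^(j+1) <= |x - a| < rho / 2^j] the kernel is at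
    most [(rho / 2^(j+1))^-m], and the shell lies in a cube of side
    [2 rho / 2^j]; the resulting bounds form a geometric series of ratio
    [2^(m-n) <= 1/2]. *)
Lemma integral_sing_kernel_le a m rho : (0 < m < n)%N -> 0 < rho ->
  (\int[mu]_t (sing_kernel a m rho t)%:E <=
    (2 ^+ (n + m).+1 * rho ^+ (n - m))%:E)%E.
Proof.
move=> /andP[m0 mn] r0.
pose r j : R := rho / 2 ^+ j.
have rj0 j : 0 < r j by rewrite divr_gt0// exprn_gt0.
pose c j : R := r j.+1 ^- m.
have c0 j : 0 <= c j by rewrite invr_ge0 exprn_ge0// ltW.
pose Q j := box (fun i => a 0 i - r j) (fun i => a 0 i - r j + (r j *+ 2)).
have mQ j : measurable (Q j) by exact: measurable_box.
pose f j t : \bar R := (c j * \1_(Q j) t)%:E.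
have f0 j t : (0 <= f j t)%E by rewrite lee_fin mulr_ge0.
have mf j : measurable_fun setT (f j).
  by apply/measurable_EFinP; apply: measurable_funM => //; exact: measurable_indic.
have intf j : (\int[mu]_t f j t = (c j * (r j *+ 2) ^+ n)%:E)%E.
  rewrite /f; under eq_integral do rewrite EFinM.
  rewrite ge0_integralZl_EFin//; last first.
    by apply/measurable_EFinP; exact: measurable_indic.
  rewrite integral_indic// setIT EFinM; congr (_ * _)%E.
  by apply: cube_measure; rewrite mulrn_wge0// ltW.
apply: (@le_trans _ _ (\int[mu]_t \sum_(0 <= j <oo) f j t)%E).
  apply: ge0_le_integral => //.
  - by move=> t _; rewrite lee_fin sing_kernel_ge0.
  - by apply/measurable_EFinP; exact: measurable_sing_kernel.
  - exact: ge0_emeasurable_sum.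
  move=> t _; rewrite /sing_kernel; case: ifPn => [dr|_]; last first.
    by apply: nneseries_ge0 => j _ _; exact: f0.
  have [d0|] := ltP 0 (dist_tuple a t); last first.
    move=> d0; have -> : dist_tuple a t = 0.
      by apply/eqP; rewrite eq_le d0 dist_tuple_ge0.
    rewrite expr0n eqn0Ngt m0 /= invr0.
    by apply: nneseries_ge0 => j _ _; exact: f0.
  have [j [jd dj]] := dyadic_scale d0 dr.
  have := @nneseries_lim_ge R (f ^~ t) xpredT 0%N j.+1 (fun _ _ _ => f0 _ _).
  apply: le_trans; rewrite big_nat_recr//=.
  apply: (@le_trans _ _ (f j t)); last first.
    by rewrite leeDr// sume_ge0// => k _; exact: f0.
  rewrite /f lee_fin indicE mem_set ?mulr1.
    by rewrite lef_pV2 ?posrE ?exprn_gt0// lerXn2r// nnegrE ltW.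
  move=> i /=; have := le_lt_trans (enorm_coord_le _ i) dj.
  rewrite !mxE ltr_distl in_itv /=.
  by rewrite -/(r j) mulr2n addrA subrK => /andP[-> /ltW].
rewrite integral_nneseries//.
have K0 : 0 <= 2 ^+ (n + m).+1 * rho ^+ (n - m).
  by rewrite mulr_ge0 ?exprn_ge0// ltW.
apply: le_trans (epsilon_trick0 xpredT K0).
apply: lee_nneseries => [j _ _|j _].
  by apply: integral_ge0 => t _; exact: f0.
rewrite intf lee_fin /c /r natrX.
have [k nE] : exists k, n = (m + k.+1)%N.
  by exists (n - m).-1; rewrite prednK ?subn_gt0// subnKC// ltnW.
have -> : (n - m)%N = k.+1 by rewrite nE addKn.
have p0 : 0 < 2 ^+ j :> R by rewrite exprn_gt0.
have rn : rho != 0 by rewrite gt_eqF.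
have -> : (rho / 2 ^+ j.+1) ^- m * ((rho / 2 ^+ j) *+ 2) ^+ n =
    (2 ^+ (n + m) * rho ^+ k.+1) / (2 ^+ j) ^+ k.+1.
  set y := rho / 2 ^+ j.
  have -> : rho / 2 ^+ j.+1 = y / 2 by rewrite exprSr invfM mulrA.
  have -> : 2 ^+ (n + m) * rho ^+ k.+1 / (2 ^+ j) ^+ k.+1 = 2 ^+ (n + m) * y ^+ k.+1.
    by rewrite -mulrA -expr_div_n.
  have : y != 0 by rewrite mulf_neq0// invr_neq0// gt_eqF.
  move: y => y /(expf_neq0 m) ym.
  have tm : (2 : R) ^+ m != 0 by rewrite expf_neq0.
  rewrite nE -[y *+ 2]mulr_natl (expr_div_n y) (exprMn _ 2 y) !exprD.
  by field; apply/andP.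
have -> : 2 ^+ (n + m).+1 * rho ^+ k.+1 / 2 ^+ j.+1 =
    2 ^+ (n + m) * rho ^+ k.+1 / 2 ^+ j.
  by rewrite !(exprS 2); field; rewrite gt_eqF.
apply: ler_wpM2l; first by rewrite mulr_ge0 ?exprn_ge0// ltW.
by rewrite lef_pV2 ?posrE ?exprn_gt0// ler_eXnr// exprn_ege1// ler1n.
Qed.

End SingularKernel.

Section Annulus.
Context {R : realType} {n : nat}.
Implicit Types (t : n.-tuple (measurableTypeR R)).

Local Notation mu := (lebesgue_measure_tuple R n).

Definition annulus_kernel (rho : R) t : R :=
  if rho <= dist_tuple 0 t < 1 then dist_tuple 0 t ^- n else 0.

Lemma annulus_kernel_ge0 rho t : 0 <= annulus_kernel rho t.
Proof.
rewrite /annulus_kernel; case: ifP => // _.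
by rewrite invr_ge0 exprn_ge0 ?dist_tuple_ge0.
Qed.

Lemma measurable_annulus_kernel rho :
  measurable_fun setT (annulus_kernel rho : _ -> R).
Proof.
apply: measurable_fun_ifT => //; last exact: measurable_dist_expVn.
by apply: measurable_and; [apply: measurable_fun_ler|apply: measurable_fun_ltr] => //;
  exact: measurable_dist_tuple.
Qed.

(** The annulus contains N disjoint cubes ]l, 2l]^n of dyadically decreasing
    side, and the integral of [|x|^-n] over each of them is at least the same
    constant [(2 n)^-n]. *)
Lemma integral_annulus_kernel_unbounded (M : R) : (0 < n)%N ->
  exists2 rho : R, 0 < rho <= 1 & (M%:E <= \int[mu]_t (annulus_kernel rho t)%:E)%E.
Proof.
move=> n0; have nR : 0 < n%:R :> R by rewrite ltr0n.
pose l j : R := (n%:R * 2 ^+ j.+2)^-1.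
have l0 j : 0 < l j by rewrite invr_gt0 mulr_gt0// exprn_gt0.
have lS j : l j = 2 * l j.+1.
  have p0 : 2 ^+ j.+2 != 0 :> R by rewrite expf_neq0.
  by rewrite /l (exprS _ j.+2); field; rewrite p0 gt_eqF.
have l_le i j : (i <= j)%N -> l j <= l i.
  move=> ij; rewrite -(subnK ij); elim: (j - i)%N => // k; apply: le_trans.
  by rewrite addSn [leRHS]lS ler_peMl ?(ltW (l0 _))// ler1n.
pose Q j : set (n.-tuple (measurableTypeR R)) := box (fun=> l j) (fun=> l j + l j).
have Qmeas : forall k, measurable (Q k) by move=> k; exact: measurable_box.
pose c : R := (2 * n%:R) ^- n.
have c0 : 0 < c by rewrite invr_gt0 exprn_gt0// mulr_gt0.
pose f j t : R := (2 * n%:R * l j) ^- n * \1_(Q j) t.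
have f0 j t : 0 <= f j t.
  by rewrite mulr_ge0// invr_ge0 exprn_ge0// !mulr_ge0// ltW.
have mf j : measurable_fun setT (EFin \o f j).
  by apply/measurable_EFinP; apply: measurable_funM => //; exact: measurable_indic.
have intf j : (\int[mu]_t (f j t)%:E = c%:E)%E.
  rewrite /f; under eq_integral do rewrite EFinM.
  rewrite ge0_integralZl_EFin//; last 2 first.
  - by apply/measurable_EFinP; exact: measurable_indic.
  - by rewrite invr_ge0 exprn_ge0// !mulr_ge0// ltW.
  rewrite integral_indic// setIT.
  transitivity (((2 * n%:R * l j) ^- n)%:E * (l j ^+ n)%:E)%E.
    by congr (_ * _)%E; apply: cube_measure; exact: ltW.
  rewrite -EFinM /c; congr EFin.
  by rewrite (exprMn _ _ (l j)) invfM mulfVK// expf_neq0// gt_eqF.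
pose N := (Num.truncn (M / c)).+1.
have lN1 : l N <= 1.
  rewrite invf_le1; last by apply: mulr_gt0 => //; exact: exprn_gt0.
  by rewrite mulr_ege1 ?ler1n// exprn_ege1// ler1n.
exists (l N); first by rewrite l0.
apply: (@le_trans _ _ (\int[mu]_t (\sum_(j < N) f j t)%:E)%E).
  under eq_integral do rewrite -sumEFin.
  rewrite ge0_integral_sum//; last 2 first.
  - by move=> j; exact: (mf j).
  - by move=> j t _; rewrite lee_fin; exact: f0.
  rewrite (eq_bigr (fun=> c%:E)) => [|j _]; last exact: intf.
  rewrite sumEFin lee_fin sumr_const card_ord -mulr_natl -ler_pdivrMr//.
  by rewrite ltW// truncnS_gt.
apply: ge0_le_integral => //.
- by move=> t _; rewrite lee_fin; apply: sumr_ge0 => j _; exact: f0.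
- apply/measurable_EFinP; apply: measurable_sum => j.
  by apply/measurable_EFinP; exact: (mf j).
- by apply/measurable_EFinP; exact: measurable_annulus_kernel.
move=> t _; rewrite lee_fin.
have [/existsP[j /asboolP tj]|/existsPn tN] :=
    boolP [exists j : 'I_N, `[< Q j t >]]; last first.
  rewrite big1 ?annulus_kernel_ge0// => j _.
  by rewrite /f indicE memNset ?mulr0//; apply/asboolPn; exact: tN.
have i0 : 'I_n by exact: Ordinal n0.
have QE k : Q k t -> l k < tnth t i0 <= 2 * l k.
  by move=> /(_ i0) /=; rewrite in_itv /= mulr2n mulrDl mul1r.
rewrite (bigD1 j)//= big1 ?addr0; last first.
  move=> i ij; rewrite /f indicE memNset ?mulr0// => /QE /andP[i1 i2].
  have /andP[j1 j2] := QE _ tj.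
  have [lij|lji|/val_inj ijE] := ltngtP i j; last by rewrite ijE eqxx in ij.
  - have := l_le _ _ lij; rewrite -(ler_pM2l (ltr0Sn R 1)) -lS => h.
    by have := lt_le_trans (le_lt_trans h i1) j2; rewrite ltxx.
  - have := l_le _ _ lji; rewrite -(ler_pM2l (ltr0Sn R 1)) -lS => h.
    by have := lt_le_trans (le_lt_trans h j1) i2; rewrite ltxx.
rewrite /f indicE mem_set// mulr1.
have coordE i : row_of_tuple t 0 i = tnth t i by rewrite mxE.
have dlo : l j < dist_tuple 0 t.
  have /andP[j1 _] := QE _ tj; apply: lt_le_trans j1 _.
  have := enorm_coord_le (row_of_tuple t) i0.
  rewrite coordE /dist_tuple subr0; exact: le_trans (ler_norm _).
have dhi : dist_tuple 0 t <= 2 * n%:R * l j.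
  have B0 : 0 <= 2 * n%:R * l j by rewrite !mulr_ge0// ltW.
  rewrite -(@ler_pXn2r _ 2)// ?nnegrE ?dist_tuple_ge0//.
  rewrite /dist_tuple subr0 enorm_sqr.
  apply: (@le_trans _ _ (\sum_(i < n) (2 * l j) ^+ 2)).
    apply: ler_sum => i _; rewrite coordE -expr2.
    have := tj i; rewrite /= in_itv /= => /andP[h1 h2].
    rewrite lerXn2r ?nnegrE ?(ltW (lt_trans (l0 j) h1))//; last first.
      by rewrite mulr2n mulrDl mul1r.
    by rewrite mulr_ge0// ltW.
  rewrite sumr_const card_ord -[_ *+ n]mulr_natl.
  have -> : (2 * n%:R * l j) ^+ 2 = n%:R ^+ 2 * (2 * l j) ^+ 2 by ring.
  by apply: ler_wpM2r; rewrite ?sqr_ge0// expr2 ler_peMl ?ler0n// ler1n.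
have d0 : 0 < dist_tuple 0 t by exact: lt_trans dlo.
rewrite /annulus_kernel (le_trans (l_le _ _ (ltnW (ltn_ord j))) (ltW dlo)) /=.
have -> : dist_tuple 0 t < 1.
  apply: le_lt_trans dhi _.
  have p0 : 2 ^+ j.+1 != 0 :> R by rewrite expf_neq0.
  have -> : 2 * n%:R * l j = (2 ^+ j.+1)^-1.
    by rewrite /l (exprS _ j.+1); field; rewrite p0 gt_eqF.
  by rewrite invf_lt1 ?exprn_gt0// exprn_egt1// ltr1n.
rewrite lef_pV2 ?posrE ?exprn_gt0// ?lerXn2r ?nnegrE ?(ltW d0)//.
  exact: le_trans (ltW d0) dhi.
exact: lt_le_trans d0 dhi.
Qed.
End Annulus.

(** * Integrals of nonnegative functions *)

Section IntegralTools.
Local Open Scope ereal_scope.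
Context d (T : measurableType d) (R : realType) (mu : {measure set T -> \bar R}).

(** The integral of a nonnegative function is a supremum over the simple
    functions below it, so it is monotone on arbitrary nonnegative functions. *)
Lemma le_integral_nonmeasurable (D E : set T) (f g : T -> \bar R) :
  (forall t, D t -> 0 <= f t) -> (forall t, E t -> 0 <= g t) ->
  (forall t, D t -> E t /\ f t <= g t) ->
  \int[mu]_(t in D) f t <= \int[mu]_(t in E) g t.
Proof.
move=> f0 g0 fg; rewrite !ge0_integralE//.
apply: le_ereal_sup => _ [h /= hf <-]; exists h => //= t.
apply: le_trans (hf t) _; rewrite /patch.
case: ifPn => [/set_mem Dt|_]; first by have [Et] := fg t Dt; rewrite mem_set.
by case: ifPn => // /set_mem; exact: g0.
Qed.

(** The gradient of [ray_proj a] has no meaningful value at [a], so the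
    energy density may be compared with its bounds only off this null set. *)
Lemma le_integral_off_null (D N : set T) (f g : T -> \bar R) :
  measurable N -> mu N = 0 ->
  (forall t, D t -> 0 <= f t) -> (forall t, 0 <= g t) -> measurable_fun setT g ->
  (forall t, D t -> ~ N t -> f t <= g t) ->
  \int[mu]_(t in D) f t <= \int[mu]_t g t.
Proof.
move=> mN N0 f0 g0 mg fg.
(* Raising g to +oo on N makes the bound hold everywhere without changing the
   integral. *)
pose G t := if t \in N then +oo else g t.
have G0 t : 0 <= G t by rewrite /G; case: ifP.
have mG : measurable_fun setT G.
  apply: measurable_fun_ifT => //; apply: (measurable_fun_bool true).
  rewrite setTI (_ : _ @^-1` _ = N)//.
  by apply/seteqP; split => t /= => [/set_mem|/mem_set].
have -> : \int[mu]_t g t = \int[mu]_t G t.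
  apply: ge0_ae_eq_integral => //.
  exists N; split => // t /= /not_implyP[_ gG].
  apply: contrapT => Nt; apply: gG; rewrite /G memNset//.
apply: le_integral_nonmeasurable => // t Dt; split => //.
rewrite /G; case: ifPn => [_|/negP];
  by [exact: leey|move=> tN; apply: fg => // /mem_set].
Qed.

End IntegralTools.

Section NonnegativeIntegrals.
Context d (T : measurableType d) (R : realType) (mu : {measure set T -> \bar R}).
Implicit Types (f g : T -> R).

Definition nnmeas f := measurable_fun setT f /\ forall t, 0 <= f t.

Local Notation I f := (\int[mu]_t (f t)%:E)%E.

Lemma nnmeasD f g : nnmeas f -> nnmeas g -> nnmeas (fun t => f t + g t).
Proof.
move=> [mf f0] [mg g0]; split=> [|t]; last exact: addr_ge0.
exact: measurable_funD.
Qed.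

Lemma nnmeasZ (k : R) f : 0 <= k -> nnmeas f -> nnmeas (fun t => k * f t).
Proof.
move=> k0 [mf f0]; split=> [|t]; last exact: mulr_ge0.
exact: measurable_funM.
Qed.

Lemma nnmeas_sum n (f : 'I_n -> T -> R) : (forall i, nnmeas (f i)) ->
  nnmeas (fun t => \sum_(i < n) f i t).
Proof.
move=> fP; split => [|t]; last by apply: sumr_ge0 => i _; exact: (fP i).2.
by apply: measurable_sum => i; exact: (fP i).1.
Qed.

Lemma integral_nnmeasD f g : nnmeas f -> nnmeas g ->
  (I (fun t => f t + g t) = I f + I g)%E.
Proof.
move=> [mf f0] [mg g0]; under eq_integral do rewrite EFinD.
rewrite ge0_integralD//; try exact/measurable_EFinP.
all: by move=> t _; rewrite lee_fin.
Qed.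

Lemma integral_nnmeasZ (k : R) f : 0 <= k -> nnmeas f ->
  (I (fun t => k * f t) = k%:E * I f)%E.
Proof.
move=> k0 [mf f0]; under eq_integral do rewrite EFinM.
rewrite ge0_integralZl_EFin//; try exact/measurable_EFinP.
by move=> t _; rewrite lee_fin.
Qed.

Lemma integral_nnmeas_sum n (f : 'I_n -> T -> R) : (forall i, nnmeas (f i)) ->
  (I (fun t => (\sum_(i < n) f i t)%R) = \sum_(i < n) I (f i))%E.
Proof.
move=> fP; under eq_integral do rewrite -sumEFin.
rewrite ge0_integral_sum// => [i|i t _]; last by rewrite lee_fin (fP i).2.
by apply/measurable_EFinP; exact: (fP i).1.
Qed.

Lemma le_integral_nnmeas f g : nnmeas f -> nnmeas g -> (forall t, f t <= g t) ->
  (I f <= I g)%E.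
Proof.
move=> [mf f0] [mg g0] fg; apply: le_integral_nonmeasurable => t _.
- by rewrite lee_fin.
- by rewrite lee_fin.
- by split => //; rewrite lee_fin.
Qed.

End NonnegativeIntegrals.

(** * Dependence of the energy on the exponent *)

Section Energy.
Context {R : realType} {n : nat}.
Implicit Types (a x : 'rV[R]_n) (t : n.-tuple (measurableTypeR R)).

Local Notation mu := (lebesgue_measure_tuple R n).

Lemma measurable_tuple_point a : measurable [set t | row_of_tuple t = a].
Proof.
rewrite (_ : [set t | _] = \bigcap_(i in [set: 'I_n])
    ((@tnth n (measurableTypeR R))^~ i @^-1` [set a 0 i])).
  apply: fin_bigcap_measurable => // i _.
  by rewrite -[X in measurable X]setTI; exact: measurable_tnth.
apply/seteqP; split => t /= ta; first by move=> i _ /=; rewrite -ta mxE.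
by apply/rowP => i; rewrite mxE; exact: ta.
Qed.

Lemma tuple_point_null a : (0 < n)%N -> mu [set t | row_of_tuple t = a] = 0%E.
Proof.
move=> n0; have mI i : measurable ([set a 0 i] : set (measurableTypeR R)) by [].
have -> : [set t | row_of_tuple t = a] = [set t | forall i, [set a 0 i] (tnth t i)].
  apply/seteqP; split => t /= ta; first by move=> i /=; rewrite -ta mxE.
  by apply/rowP => i; rewrite mxE; exact: ta.
rewrite (product_measure_tuple_box (@lebesgue_measure R) mI).
rewrite (bigD1 (Ordinal n0))//= [X in (X * _)%E](_ : _ = 0%E) ?mul0e//.
exact: lebesgue_measure_set1.
Qed.

Lemma weighted_energy_le (alpha : R) a (g : _ -> R) : (0 < n)%N -> nnmeas g ->
  (forall t, enorm (row_of_tuple t) < 1 -> row_of_tuple t != a ->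
     enorm (row_of_tuple t) `^ alpha * grad_norm (ray_proj a) (row_of_tuple t) ^+ 2
       <= g t) ->
  (weighted_energy alpha (ray_proj a) <= \int[mu]_t (g t)%:E)%E.
Proof.
move=> n0 [mg g0] ag; rewrite /weighted_energy /integral_rV.
apply: (le_integral_off_null (measurable_tuple_point a) (tuple_point_null a n0)).
- by move=> t _; rewrite lee_fin (mulr_ge0 (powR_ge0 _ _))// sqr_ge0.
- by move=> t; rewrite lee_fin.
- exact/measurable_EFinP.
- by move=> t Dt ta; rewrite lee_fin; apply: ag => //; apply/eqP.
Qed.

(** On the unit ball [r `^ alpha] decreases in [alpha]; at the origin both
    weights are 0 by convention. *)
Lemma weighted_energy_nonincreasing (alpha beta : R) a : beta <= alpha -> alpha < 0 ->
  (weighted_energy alpha (ray_proj a) <= weighted_energy beta (ray_proj a))%E.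
Proof.
move=> ba a0; apply: le_integral_nonmeasurable => t D.
- by rewrite lee_fin (mulr_ge0 (powR_ge0 _ _))// sqr_ge0.
- by rewrite lee_fin (mulr_ge0 (powR_ge0 _ _))// sqr_ge0.
split => //; rewrite lee_fin.
apply: ler_wpM2r; first exact: sqr_ge0.
have [r0|r0] := eqVneq (enorm (row_of_tuple t)) 0.
  by rewrite r0 !powR0// ?lt_eqF// (le_lt_trans ba).
apply: ger_powR => //; rewrite lt0r r0 enorm_ge0 /=.
exact: ltW.
Qed.

Definition ball_powR (p : R) t : R :=
  if dist_tuple 0 t < 1 then dist_tuple 0 t `^ p else 0.

Lemma nnmeas_ball_powR p : nnmeas (ball_powR p).
Proof.
split=> [|t]; last by rewrite /ball_powR; case: ifP => // _; exact: powR_ge0.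
apply: measurable_fun_ifT => //.
  by apply: measurable_fun_ltr => //; exact: measurable_dist_tuple.
exact: (measurableT_comp (measurable_powR _)) (measurable_dist_tuple 0).
Qed.

Lemma grad_norm_ray_proj0 x : x != 0 ->
  grad_norm (ray_proj 0) x ^+ 2 = (n%:R - 1) * enorm x ^- 2.
Proof.
move=> x0; have b0 : unit_ball (0 : 'rV[R]_n).
  apply/unit_ball_sqr; rewrite (_ : dotv 0 0 = 0) ?ltr01//.
  by apply/eqP; rewrite dotvv_eq0.
have d0 y : dotv (0 : 'rV[R]_n) y = 0 by apply: big1 => i _; rewrite mxE mul0r.
rewrite grad_norm_ray_proj// ray_coefE// /ray_disc subr0 !d0 !subr0 expr0n add0r mulr1.
have q0 : 0 < dotv x x by rewrite dotvv_gt0.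
rewrite enorm_sqr expr_div_n sqr_sqrtr ?ltW//.
by field; rewrite gt_eqF.
Qed.

(** The identity of the integrands also holds at the origin, where both vanish
    because [0 `^ p = 0] for [p != 0]. *)
Lemma weighted_energy_center (alpha : R) : (0 < n)%N -> alpha < 0 ->
  (weighted_energy alpha (ray_proj (0 : 'rV[R]_n)) =
     (n%:R - 1)%:E * \int[mu]_t (ball_powR (alpha - 2) t)%:E)%E.
Proof.
move=> n0 a0; have n1 : 0 <= n%:R - 1 :> R by rewrite subr_ge0 ler1n.
rewrite -integral_nnmeasZ//; last exact: nnmeas_ball_powR.
rewrite /weighted_energy /integral_rV [LHS]integral_mkcond.
apply: eq_integral => t _; rewrite /patch /ball_powR /dist_tuple subr0.
case: ifPn => [/set_mem /= ->|/negP tD]; last first.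
  by case: ifPn; rewrite ?mulr0// => h; exfalso; apply: tD; rewrite inE.
congr EFin; have [x0|x0] := eqVneq (row_of_tuple t) 0.
  have -> : enorm (row_of_tuple t) = 0 by apply/eqP; rewrite enorm_eq0 x0.
  rewrite !powR0 ?mul0r ?mulr0// lt_eqF//.
  by rewrite subr_lt0 (lt_trans a0).
rewrite grad_norm_ray_proj0// mulrCA; congr (_ * _).
rewrite powRB; last by rewrite enorm_eq0 x0 implybT.
by rewrite powR_mulrn ?enorm_ge0.
Qed.

End Energy.

Section Semicontinuity.
Context {R : realType} {n : nat}.
Local Notation mu := (lebesgue_measure_tuple R n).

(** The weights [r `^ alpha] increase to [r `^ beta] as [alpha] decreases
    to [beta], so monotone convergence applies. *)
Lemma weighted_energy_center_lsc (beta gamma : R) (m : \bar R) : (0 < n)%N ->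
  beta < gamma -> gamma <= 0 ->
  (m < weighted_energy beta (ray_proj (0 : 'rV[R]_n)))%E ->
  exists2 alpha0, beta < alpha0 < gamma &
    forall alpha, beta < alpha -> alpha <= alpha0 ->
      (m < weighted_energy alpha (ray_proj (0 : 'rV[R]_n)))%E.
Proof.
move=> n0 bg g0 mE.
have n1 : 0 <= n%:R - 1 :> R by rewrite subr_ge0 ler1n.
pose h : R := (gamma - beta) / 2.
have h0 : 0 < h by rewrite divr_gt0// subr_gt0.
pose e k : R := beta + h * harmonic k.
have eb k : beta < e k by rewrite ltrDl mulr_gt0// invr_gt0.
have eg k : e k < gamma.
  have : h * harmonic k <= h by rewrite ger_pMr// invf_le1// ler1n.
  by move: bg; rewrite /e /h; lra.
have e_le k l : (k <= l)%N -> e l <= e k.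
  move=> kl; rewrite lerD2l ler_wpM2l ?(ltW h0)//.
  by rewrite lef_pV2 ?posrE// ler_nat.
have ecvg : e k @[k --> \oo] --> beta.
  rewrite -[X in _ --> X]addr0 -[X in _ + X](mulr0 h).
  apply: cvgD; first exact: cvg_cst.
  by apply: cvgM; [exact: cvg_cst|exact: cvg_harmonic].
pose g k (t : n.-tuple (measurableTypeR R)) : \bar R :=
  ((n%:R - 1) * ball_powR (e k - 2) t)%:E.
have gE k : (\int[mu]_t g k t = weighted_energy (e k) (ray_proj (0 : 'rV[R]_n)))%E.
  rewrite weighted_energy_center ?(lt_le_trans (eg k))//.
  by rewrite -integral_nnmeasZ//; exact: nnmeas_ball_powR.
have Zg k := nnmeasZ n1 (@nnmeas_ball_powR R n (e k - 2)).
have mg k : measurable_fun setT (g k) by apply/measurable_EFinP; exact: (Zg k).1.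
have g_ge0 k t : setT t -> (0 <= g k t)%E by move=> _; rewrite lee_fin; exact: (Zg k).2.
have nd_g t : setT t -> nondecreasing_seq (g ^~ t).
  move=> _ k l kl; rewrite lee_fin ler_wpM2l// /ball_powR; case: ifP => // r1.
  have [->|r0] := eqVneq (dist_tuple 0 t) 0.
    have e0 j : e j - 2 != 0.
      by rewrite lt_eqF// subr_lt0 (lt_le_trans (eg j))// (le_trans g0).
    by rewrite !powR0.
  apply: ger_powR; first by rewrite lt0r r0 dist_tuple_ge0 ltW.
  by rewrite lerD2r e_le.
have cvgE := cvg_monotone_convergence measurableT mg g_ge0 nd_g (mu := mu).
have limE t : limn (g ^~ t) = ((n%:R - 1) * ball_powR (beta - 2) t)%:E.
  apply/cvg_lim => //; apply: cvg_EFin; first exact: nearW.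
  apply: cvgM; first exact: cvg_cst.
  rewrite /= /ball_powR; case: ifP => _; last exact: cvg_cst.
  have [->|r0] := eqVneq (dist_tuple 0 t) 0.
    have p0 p : p < 0 -> p - 2 != 0 :> R.
      by move=> p0; rewrite lt_eqF// subr_lt0 (lt_trans p0).
    rewrite powR0 ?p0 ?(lt_le_trans bg)//.
    apply: cvg_near_cst; apply: nearW => k.
    by rewrite powR0// p0// (lt_le_trans (eg k)).
  rewrite /powR (negbTE r0).
  apply: continuous_cvg; first exact: continuous_expR.
  apply: cvgM; last exact: cvg_cst.
  by apply: cvgB => //; exact: cvg_cst.
have [k mk] : exists k, (m < weighted_energy (e k) (ray_proj (0 : 'rV[R]_n)))%E.
  apply: contrapT => /forallNP mk.
  move: mE; apply/negP; rewrite -leNgt.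
  rewrite weighted_energy_center ?(lt_le_trans bg)//.
  rewrite -integral_nnmeasZ//; last exact: nnmeas_ball_powR.
  under eq_integral do rewrite -limE.
  rewrite -(cvg_lim _ cvgE)//; apply: lime_le.
    by apply/cvg_ex; eexists; exact: cvgE.
  by apply: nearW => k; rewrite gE leNgt; exact/negP.
exists (e k); first by rewrite eb eg.
move=> alpha ba ae; apply: lt_le_trans mk _.
by apply: weighted_energy_nonincreasing => //; rewrite (lt_le_trans (eg k)).
Qed.

End Semicontinuity.

(** * Pointwise bounds on the energy density *)

Section GradientBounds.
Context {R : realType} {n : nat}.
Implicit Types (a x y : 'rV[R]_n).

Lemma dotv_le_enorm a x : `|dotv a x| <= enorm a * enorm x.
Proof.
rewrite -(@ler_pXn2r _ 2)//; last by rewrite nnegrE mulr_ge0 ?enorm_ge0.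
by rewrite real_normK ?num_real// exprMn !enorm_sqr cauchy_schwarz.
Qed.

Lemma enorm_triangle x y : enorm (x + y) <= enorm x + enorm y.
Proof.
have s0 : 0 <= enorm x + enorm y by rewrite addr_ge0 ?enorm_ge0.
rewrite -(@ler_pXn2r _ 2)// ?nnegrE ?enorm_ge0// enorm_sqr.
have := dotvv_line x y 1; rewrite scale1r => ->; rewrite sqrrD !enorm_sqr.
by have := le_trans (ler_norm _) (dotv_le_enorm x y); lra.
Qed.

Lemma enormN x : enorm (- x) = enorm x.
Proof.
rewrite !enormE; congr Num.sqrt.
by apply: eq_bigr => i _; rewrite !mxE mulrNN.
Qed.

(** The number [ray_disc a x] lies between [(1 - |a|^2) |x - a|^2] and
    [|x - a|^2]; its square root is thus at most [|x - a|], which bounds the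
    numerator of [ray_coef] in a form without square roots. *)
Lemma grad_norm_ray_proj_le a x : (1 < n)%N -> unit_ball a -> x != a ->
  grad_norm (ray_proj a) x ^+ 2 <=
  (1 - dotv a (x - a) / enorm (x - a)) ^+ 2 *
  (n%:R - 2 + (1 - enorm a ^+ 2)^-1) * enorm (x - a) ^- 2.
Proof.
move=> n1 a1 xa; have := unit_ball_sqr a; case => /(_ a1) A1 _.
rewrite grad_norm_ray_proj// ray_coefE//.
set y := x - a; set p := dotv a y.
have D0 := ray_disc_gt0 a1 xa.
have q0 : 0 < dotv y y by rewrite dotvv_gt0 subr_eq0.
have d0 : 0 < enorm y by rewrite enorm_gt0 subr_eq0.
have n2 : 0 <= n%:R - 2 :> R by rewrite subr_ge0 ler_nat.
have c0 : 0 < 1 - enorm a ^+ 2 by rewrite enorm_sqr subr_gt0.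
have p2 : p ^+ 2 <= enorm a ^+ 2 * enorm y ^+ 2 by rewrite !enorm_sqr cauchy_schwarz.
have DE : ray_disc a x = p ^+ 2 + enorm y ^+ 2 * (1 - enorm a ^+ 2).
  by rewrite !enorm_sqr.
have Dq : ray_disc a x <= enorm y ^+ 2 by rewrite DE; nra.
have sd : Num.sqrt (ray_disc a x) <= enorm y.
  by rewrite -(ger0_norm (enorm_ge0 y)) -sqrtr_sqr ler_wsqrtr.
have sp : p <= Num.sqrt (ray_disc a x).
  rewrite (le_trans (ler_norm _))// -sqrtr_sqr ler_wsqrtr// DE lerDl.
  by rewrite mulr_ge0 ?sqr_ge0 ?ltW.
have lin : (Num.sqrt (ray_disc a x) - p) / dotv y y <= (1 - p / enorm y) / enorm y.
  have -> : (1 - p / enorm y) / enorm y = (enorm y - p) / dotv y y.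
    by rewrite -enorm_sqr; field; rewrite gt_eqF.
  by rewrite ler_pM2r ?invr_gt0// lerD2r.
rewrite [leRHS]mulrAC -[in leRHS]expr_div_n; apply: ler_pM.
- exact: sqr_ge0.
- by rewrite addr_ge0// divr_ge0 ?ltW.
- have l0 : 0 <= (Num.sqrt (ray_disc a x) - p) / dotv y y.
    by rewrite divr_ge0 ?(ltW q0)// subr_ge0.
  by rewrite lerXn2r ?nnegrE ?(le_trans l0).
- rewrite lerD2l ler_pdivrMr// mulrC ler_pdivlMr// DE enorm_sqr.
  by rewrite -enorm_sqr lerDr sqr_ge0.
Qed.

Lemma grad_norm_ray_proj_le_dist a x : (1 < n)%N -> unit_ball a -> x != a ->
  grad_norm (ray_proj a) x ^+ 2 <=
  4 * (n%:R - 2 + (1 - enorm a ^+ 2)^-1) * enorm (x - a) ^- 2.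
Proof.
move=> n1 a1 xa; apply: le_trans (grad_norm_ray_proj_le n1 a1 xa) _.
have d0 : 0 < enorm (x - a) by rewrite enorm_gt0 subr_eq0.
have c0 : 0 < 1 - enorm a ^+ 2.
  by rewrite subr_gt0 expr_lt1 ?enorm_ge0.
apply: ler_wpM2r; first by rewrite invr_ge0 sqr_ge0.
apply: ler_wpM2r; first by rewrite addr_ge0 ?invr_ge0 ?(ltW c0)// subr_ge0 ler_nat.
have := dotv_le_enorm a (x - a).
rewrite -ler_pdivrMr// => h.
have : `|dotv a (x - a) / enorm (x - a)| <= 1.
  rewrite normrM normfV (ger0_norm (enorm_ge0 (x - a))).
  by rewrite (le_trans h)// ltW.
by rewrite ler_norml => /andP[]; nra.
Qed.

(** [first_order_bound A d p] is what remains of the bound on the energy density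
    when only the term of first order in [a] is kept exactly; [A] stands for
    [|a|^2], [d] for [|x - a|] and [p] for the scalar product of [a] and
    [x - a]. *)
Definition first_order_bound (A d p : R) : R :=
  ((n%:R - 1) * (1 - 2 * (p / d)) + (n%:R + 2) * A) * d ^- 2.

Lemma first_order_bound_ge0 a x : (1 < n)%N -> enorm a <= 2^-1 ->
  0 <= first_order_bound (enorm a ^+ 2) (enorm (x - a)) (dotv a (x - a)).
Proof.
move=> n1 a2; rewrite /first_order_bound.
have [->|d0] := eqVneq (enorm (x - a)) 0; first by rewrite expr0n invr0 mulr0.
rewrite mulr_ge0 ?invr_ge0 ?sqr_ge0// addr_ge0//; last first.
  by rewrite mulr_ge0 ?sqr_ge0// addr_ge0.
rewrite mulr_ge0 ?subr_ge0 ?ler1n 1?ltnW//.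
have dp : 0 < enorm (x - a) by rewrite lt0r d0 enorm_ge0.
have h : dotv a (x - a) <= 2^-1 * enorm (x - a).
  rewrite (le_trans (ler_norm _))// (le_trans (dotv_le_enorm _ _))//.
  by rewrite ler_wpM2r ?enorm_ge0.
have : dotv a (x - a) / enorm (x - a) <= 2^-1 by rewrite ler_pdivrMr.
lra.
Qed.

Lemma grad_norm_ray_proj_first_order a x : (1 < n)%N -> enorm a <= 2^-1 -> x != a ->
  grad_norm (ray_proj a) x ^+ 2 <=
  first_order_bound (enorm a ^+ 2) (enorm (x - a)) (dotv a (x - a)).
Proof.
move=> n1 a2 xa; have a0 := enorm_ge0 a.
have a1 : unit_ball a by rewrite /unit_ball /=; lra.
apply: le_trans (grad_norm_ray_proj_le n1 a1 xa) _.
have d0 : 0 < enorm (x - a) by rewrite enorm_gt0 subr_eq0.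
apply: ler_wpM2r; first by rewrite invr_ge0 sqr_ge0.
have n2 : 1 <= n%:R - 1 :> R by rewrite lerBrDr -(natrD _ 1 1) ler_nat.
set s := dotv a (x - a) / enorm (x - a).
have : `|s| <= enorm a.
  rewrite normrM normfV (ger0_norm (enorm_ge0 (x - a))).
  by rewrite ler_pdivrMr// dotv_le_enorm.
set A := enorm a ^+ 2.
have A4 : A <= 4^-1 by rewrite /A; nra.
have A0 : 0 <= A by exact: sqr_ge0.
rewrite ler_norml => /andP[s1 s2].
have s2A : s ^+ 2 <= A by rewrite /A; nra.
have s3 : (1 - s) ^+ 2 <= 9 / 4 by nra.
have iA : (1 - A)^-1 <= 1 + 4 / 3 * A.
  rewrite -[leLHS]mul1r ler_pdivrMr; last by lra.
  nra.
apply: (@le_trans _ _ ((1 - s) ^+ 2 * (n%:R - 1 + 4 / 3 * A))).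
  by rewrite ler_wpM2l ?sqr_ge0//; lra.
have -> : (1 - s) ^+ 2 * (n%:R - 1 + 4 / 3 * A) =
   (n%:R - 1) * (1 - 2 * s) + (n%:R - 1) * s ^+ 2 + (1 - s) ^+ 2 * (4 / 3 * A).
  by ring.
have h1 : (n%:R - 1) * s ^+ 2 <= (n%:R - 1) * A by rewrite ler_wpM2l//; lra.
have h2 : (1 - s) ^+ 2 * (4 / 3 * A) <= 3 * A by nra.
lra.
Qed.

End GradientBounds.

Section AveragedDensity.
Context {R : realType} {n : nat}.
Implicit Types (a x : 'rV[R]_n).

Local Notation fob := (@first_order_bound R n).

(** For [d > 0] the left-hand side is nonpositive, since [d <= e]; for [d = 0]
    the hypotheses force [X = A], and [d ^- 3] is 0 by convention. *)
Lemma inv_cube_imbalance (q X A d e : R) : 0 <= d -> 0 <= e -> 0 <= X -> 0 <= A ->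
  X ^+ 2 <= q * A -> d ^+ 2 = q - 2 * X + A -> e ^+ 2 = q + 2 * X + A ->
  X * (e ^- 3 - d ^- 3) <= A * (d ^- 3 + e ^- 3).
Proof.
move=> d0 e0 X0 A0 XA dE eE.
have e3 : 0 <= e ^- 3 by rewrite invr_ge0 exprn_ge0.
have d3 : 0 <= d ^- 3 by rewrite invr_ge0 exprn_ge0.
have [dz|dn] := eqVneq d 0.
  have AX : X = A.
    have : 2 * X = q + A by move: dE; rewrite dz expr0n /=; lra.
    move=> h; have : (q - A) ^+ 2 <= 0 by nra.
    move=> h2; have : q - A = 0.
      by apply/eqP; rewrite -sqrf_eq0 eq_le h2 sqr_ge0.
    lra.
  by rewrite dz expr0n /= invr0 subr0 add0r AX.
have dp : 0 < d by rewrite lt0r dn.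
have de : d <= e by rewrite -(@ler_pXn2r _ 2)// dE eE; lra.
have : e ^- 3 <= d ^- 3.
  by rewrite lef_pV2 ?posrE ?exprn_gt0 ?(lt_le_trans dp)// lerXn2r ?nnegrE.
have := mulr_ge0 A0 e3; have := mulr_ge0 A0 d3; nra.
Qed.

Lemma inv_sqr_le_inv_cube (d : R) : 0 <= d -> d <= 2 -> d ^- 2 <= 2 * d ^- 3.
Proof.
move=> d0 d2; have [->|dn] := eqVneq d 0; first by rewrite !expr0n /= invr0 mulr0.
have dp : 0 < d by rewrite lt0r dn.
have -> : d ^- 2 = d * d ^- 3 by field.
by rewrite ler_wpM2r// invr_ge0 exprn_ge0.
Qed.

(** Adding the bounds for [a] and [- a] turns the first-order terms into a
    difference of inverse cubes whose sign is favourable up to a multiple of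
    [|a|^2]. *)
Lemma first_order_bound_pair a x : (0 < n)%N ->
  enorm (x - a) <= 2 -> enorm (x + a) <= 2 ->
  fob (enorm a ^+ 2) (enorm (x - a)) (dotv a (x - a)) +
  fob (enorm a ^+ 2) (enorm (x + a)) (dotv (- a) (x + a)) <=
  (n%:R - 1) * (enorm (x - a) ^- 2 + enorm (x + a) ^- 2) +
  6 * n%:R * enorm a ^+ 2 * (enorm (x - a) ^- 3 + enorm (x + a) ^- 3).
Proof.
move=> n0 d2 e2; set d := enorm (x - a) in d2 *; set e := enorm (x + a) in e2 *.
set A := enorm a ^+ 2; set X := dotv a x; set q := enorm x ^+ 2.
have d0 : 0 <= d by exact: enorm_ge0.
have e0 : 0 <= e by exact: enorm_ge0.
have A0 : 0 <= A by exact: sqr_ge0.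
have XA : X ^+ 2 <= q * A by rewrite /X /q /A !enorm_sqr mulrC cauchy_schwarz.
have dE : d ^+ 2 = q - 2 * X + A.
  have := dotvv_line x a (- 1); rewrite scaleN1r -enorm_sqr -/d => ->.
  by rewrite /q /X /A !enorm_sqr (dotvC x); ring.
have eE : e ^+ 2 = q + 2 * X + A.
  have := dotvv_line x a 1; rewrite scale1r -enorm_sqr -/e => ->.
  by rewrite /q /X /A !enorm_sqr (dotvC x); ring.
have pE : dotv a (x - a) = X - A by rewrite dotvBr /A enorm_sqr.
have p'E : dotv (- a) (x + a) = - X - A.
  rewrite dotvC -scaleN1r dotvZr dotvC dotvDr /A enorm_sqr -/X; ring.
have key : - (X - A) * d ^- 3 + (X + A) * e ^- 3 <= 2 * A * (d ^- 3 + e ^- 3).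
  have [X0|X0] := leP 0 X.
    by have := inv_cube_imbalance d0 e0 X0 A0 XA dE eE; nra.
  have NX0 : 0 <= - X by rewrite oppr_ge0 ltW.
  have NXA : (- X) ^+ 2 <= q * A by rewrite sqrrN.
  have dE' : d ^+ 2 = q + 2 * - X + A by rewrite dE; ring.
  have eE' : e ^+ 2 = q - 2 * - X + A by rewrite eE; ring.
  by have := inv_cube_imbalance e0 d0 NX0 A0 NXA eE' dE'; nra.
have h1 := inv_sqr_le_inv_cube d0 d2; have h2 := inv_sqr_le_inv_cube e0 e2.
have expand (c p : R) : fob A c p =
    (n%:R - 1) * c ^- 2 - 2 * (n%:R - 1) * (p * c ^- 3) + (n%:R + 2) * A * c ^- 2.
  by rewrite /first_order_bound -!exprVn; ring.
rewrite !expand pE p'E.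
have n1 : 0 <= n%:R - 1 :> R by rewrite subr_ge0 ler1n.
have := ler_wpM2l n1 key.
have nA : 0 <= (n%:R + 2) * A by rewrite mulr_ge0// addr_ge0.
have := ler_wpM2l nA h1; have := ler_wpM2l nA h2.
move: (d ^- 2) (e ^- 2) (d ^- 3) (e ^- 3) => d2' e2' d3' e3' ? ? ?; lra.
Qed.

(** The function [|x|^-2] is superharmonic in dimension n > 4; this is the
    resulting quantitative defect in the mean over the 2 n points
    [x +- delta e_i]. *)
Lemma sum_inv_sqr_shift x (delta : R) : (6 <= n)%N -> 0 < delta ->
  5 * delta <= enorm x ->
  \sum_(i < n) (enorm (x - delta *: delta_mx 0 i) ^- 2 +
                enorm (x + delta *: delta_mx 0 i) ^- 2) <=
  2 * n%:R * enorm x ^- 2 - delta ^+ 2 * enorm x ^- 4.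
Proof.
move=> n6 de0 dx; set q := enorm x ^+ 2; set D := delta ^+ 2.
have D0 : 0 < D by rewrite exprn_gt0.
have qD : 25 * D <= q by rewrite /q /D; nra.
have q0 : 0 < q by lra.
pose Q := q + D; have Q0 : 0 < Q by rewrite addr_gt0.
have sq s i : s ^+ 2 = 1 -> enorm (x + (s * delta) *: delta_mx 0 i) ^+ 2 =
    Q + 2 * s * delta * x 0 i.
  move=> s1; rewrite enorm_sqr dotvv_line !dotv_delta !mxE !eqxx -enorm_sqr -/q.
  by rewrite /Q /D exprMn s1 /=; ring.
(* The left-hand side is (2 / Q) / (1 - z) with z = 4 D x_i^2 / Q^2 <= 1 / 5,
   and 1 / (1 - z) <= 1 + (5 / 4) z for such z. *)
have term i : enorm (x - delta *: delta_mx 0 i) ^- 2 +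
    enorm (x + delta *: delta_mx 0 i) ^- 2 <= 2 / Q + 10 * D / Q ^+ 3 * (x 0 i * x 0 i).
  have := sq 1 i (expr1n _ _); rewrite mul1r => ->.
  have := sq (-1) i; rewrite sqrrN expr1n mulN1r scaleNr => /(_ erefl) ->.
  have X2 : x 0 i ^+ 2 <= q.
    rewrite -(@real_normK _ (x 0 i)) ?num_real// lerXn2r ?nnegrE ?enorm_ge0//.
    exact: enorm_coord_le.
  set X := x 0 i in X2 *.
  pose Z := D * X ^+ 2.
  have Z0 : 0 <= Z by rewrite mulr_ge0 ?sqr_ge0// ltW.
  have ZQ : 20 * Z <= Q ^+ 2 by rewrite /Z /Q; nra.
  have P0 : 0 < Q ^+ 2 - 4 * Z by have := exprn_gt0 2 Q0; lra.
  have PE : (Q - 2 * delta * X) * (Q + 2 * delta * X) = Q ^+ 2 - 4 * Z.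
    by rewrite /Z /D; ring.
  have u0 : Q - 2 * delta * X != 0.
    by apply/eqP => u; move: P0; rewrite -PE u mul0r ltxx.
  have v0 : Q + 2 * delta * X != 0.
    by apply/eqP => u; move: P0; rewrite -PE u mulr0 ltxx.
  have -> : (Q + 2 * -1 * delta * X)^-1 + (Q + 2 * 1 * delta * X)^-1 =
      2 * Q / (Q ^+ 2 - 4 * Z).
    by rewrite -PE; field; rewrite u0 v0.
  have -> : 2 / Q + 10 * D / Q ^+ 3 * (X * X) = (2 * Q ^+ 2 + 10 * Z) / Q ^+ 3.
    by rewrite /Z; field; rewrite gt_eqF.
  rewrite ler_pdivrMr// mulrAC ler_pdivlMr ?exprn_gt0//.
  have := mulr_ge0 Z0 (ltW P0); nra.
apply: (le_trans (ler_sum _ (fun i _ => term i))).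
rewrite big_split /= sumr_const card_ord -mulr_sumr -/(dotv x x) -enorm_sqr -/q.
have nR : 6 <= n%:R :> R by rewrite ler_nat.
have -> : enorm x ^- 4 = q ^- 2 by rewrite /q -exprM.
rewrite -subr_ge0 -[(2 / Q) *+ n]mulr_natl.
have -> : 2 * n%:R / q - D / q ^+ 2 - (n%:R * (2 / Q) + 10 * D / Q ^+ 3 * q) =
  D * (2 * n%:R * q * Q ^+ 2 - Q ^+ 3 - 10 * q ^+ 3) / (q ^+ 2 * Q ^+ 3).
  by rewrite /Q; field; rewrite !gt_eqF.
have q3 : 0 < q ^+ 2 * Q ^+ 3 by apply: mulr_gt0; exact: exprn_gt0.
apply: divr_ge0 (ltW q3); apply: mulr_ge0 (ltW D0) _.
have QQ : q <= Q by rewrite lerDl ltW.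
have Q2q : Q <= 2 * q by rewrite /Q; lra.
(* The gain 2 n D / (q Q) of replacing q by Q is at least 12 D / (q Q), and the
   second-order terms add up to at most 10 D / (q Q). *)
have h1 : 12 * (q * Q ^+ 2) <= 2 * n%:R * (q * Q ^+ 2).
  by apply: ler_wpM2r; [exact: mulr_ge0 (ltW q0) (sqr_ge0 _)|lra].
have h2 : Q ^+ 3 <= 2 * (q * Q ^+ 2).
  by rewrite exprS mulrA ler_wpM2r ?sqr_ge0.
have h3 : q ^+ 3 <= q * Q ^+ 2.
  by rewrite exprS ler_wpM2l ?(ltW q0)// lerXn2r ?nnegrE ?(ltW q0) ?(ltW Q0).
lra.
Qed.

(** A product of two singularities is dominated by the sum of two single ones of
    the same total order: compare both factors with the larger one. *)
Lemma inv_pow_mul_le (r d : R) (j k : nat) : (0 < j)%N -> (0 < k)%N ->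
  0 <= r -> 0 <= d -> r ^- j * d ^- k <= r ^- (j + k) + d ^- (j + k).
Proof.
move=> j0 k0 r0 d0; rewrite -!exprVn !exprD.
have r'0 : 0 <= r^-1 by rewrite invr_ge0.
have d'0 : 0 <= d^-1 by rewrite invr_ge0.
have [rd|dr] := leP r^-1 d^-1.
  rewrite ler_wpDl ?mulr_ge0 ?exprn_ge0//.
  by rewrite ler_wpM2r ?exprn_ge0// lerXn2r ?nnegrE.
rewrite ler_wpDr ?mulr_ge0 ?exprn_ge0//.
by rewrite ler_wpM2l ?exprn_ge0// lerXn2r ?nnegrE// ltW.
Qed.

End AveragedDensity.

(** * Energies at the end exponents *)

Section Comparison.
Context {R : realType} {n : nat}.
Implicit Types (a x : 'rV[R]_n) (t : n.-tuple (measurableTypeR R)).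

Local Notation mu := (lebesgue_measure_tuple R n).
Local Notation fob := (@first_order_bound R n).

Lemma dist_tuple0 t : dist_tuple 0 t = enorm (row_of_tuple t).
Proof. by rewrite /dist_tuple subr0. Qed.

Lemma enorm_delta (delta : R) (i : 'I_n) : 0 <= delta ->
  enorm (delta *: delta_mx 0 i : 'rV[R]_n) = delta.
Proof.
move=> d0; rewrite enormE dotvZr dotv_delta !mxE !eqxx mulr1 -expr2 sqrtr_sqr.
exact: ger0_norm.
Qed.

Lemma nnmeas_sing_kernel a m rho : nnmeas (@sing_kernel R n a m rho).
Proof. by split; [exact: measurable_sing_kernel|exact: sing_kernel_ge0]. Qed.

Lemma nnmeas_annulus_kernel rho : nnmeas (@annulus_kernel R n rho).
Proof. by split; [exact: measurable_annulus_kernel|exact: annulus_kernel_ge0]. Qed.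

Lemma weighted_energy_center_critical : (2 < n)%N ->
  weighted_energy (- n%:R + 2) (ray_proj (0 : 'rV[R]_n)) = +oo%E.
Proof.
move=> n3; have n0 : (0 < n)%N by exact: ltn_trans n3.
have nR : 3 <= n%:R :> R by rewrite ler_nat.
rewrite weighted_energy_center//; last by lra.
suff -> : (\int[mu]_t (ball_powR (- n%:R + 2 - 2) t)%:E = +oo)%E.
  by rewrite gt0_muley// lte_fin; lra.
apply/eqyP => M _; have [rho _ Mle] := integral_annulus_kernel_unbounded M n0.
apply: le_trans Mle _; apply: le_integral_nnmeas.
- exact: nnmeas_annulus_kernel.
- exact: nnmeas_ball_powR.
move=> t; rewrite /annulus_kernel /ball_powR addrK.
case: (dist_tuple 0 t < 1); last by rewrite andbF.
rewrite andbT powR_invn ?dist_tuple_ge0//; case: ifP => // _.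
by rewrite invr_ge0 exprn_ge0 ?dist_tuple_ge0.
Qed.

(** For [a != 0] the two singularities of the integrand, [|x|^(2-n)] at 0 and
    [|x - a|^-2] at [a], lie at distinct points, and each is integrable. *)
Lemma weighted_energy_critical_fin a : (2 < n)%N -> unit_ball a -> a != 0 ->
  (weighted_energy (- n%:R + 2) (ray_proj a) < +oo)%E.
Proof.
move=> n3 a1 a0; have n0 : (0 < n)%N by exact: ltn_trans n3.
have n2 : (0 < n - 2 < n)%N by rewrite subn_gt0 n3 ltn_subrL.
have nR : 3 <= n%:R :> R by rewrite ler_nat.
have A0 : 0 < enorm a by rewrite enorm_gt0.
have c0 : 0 < 1 - enorm a ^+ 2 by rewrite subr_gt0 expr_lt1 ?enorm_ge0.
pose C : R := 4 * (n%:R - 2 + (1 - enorm a ^+ 2)^-1).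
have C0 : 0 <= C.
  by rewrite mulr_ge0// addr_ge0 ?invr_ge0 ?(ltW c0)//; lra.
pose e := enorm a / 2.
have e0 : 0 < e by rewrite divr_gt0.
have k1 : 0 <= C * e ^- 2 by rewrite mulr_ge0// invr_ge0 exprn_ge0// ltW.
have k2 : 0 <= C * e ^- (n - 2) by rewrite mulr_ge0// invr_ge0 exprn_ge0// ltW.
have P1 := nnmeasZ k1 (nnmeas_sing_kernel 0 (n - 2) 1).
have P2 := nnmeasZ k2 (nnmeas_sing_kernel a 2 2).
apply: (@le_lt_trans _ _ (\int[mu]_t (C * e ^- 2 * sing_kernel 0 (n - 2) 1 t +
   C * e ^- (n - 2) * sing_kernel a 2 2 t)%:E)%E); last first.
  rewrite integral_nnmeasD// !integral_nnmeasZ//; try exact: nnmeas_sing_kernel.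
  apply: le_lt_trans (ltry (C * e ^- 2 * (2 ^+ (n + (n - 2)).+1 * 1 ^+ (n - (n - 2)))
    + C * e ^- (n - 2) * (2 ^+ (n + 2).+1 * 2 ^+ (n - 2)))).
  rewrite EFinD (EFinM (C / e ^+ 2)) (EFinM (C / e ^+ (n - 2))).
  apply: leeD; apply: lee_wpmul2l; rewrite ?lee_fin//.
    exact: integral_sing_kernel_le.
  exact: integral_sing_kernel_le.
apply: weighted_energy_le => //; first exact: nnmeasD.
move=> t t1 ta; set x := row_of_tuple t in t1 ta *.
rewrite /sing_kernel dist_tuple0 -/x t1 /dist_tuple -/x.
have d2 : enorm (x - a) < 2.
  have := enorm_triangle x (- a); rewrite enormN.
  by move: a1; rewrite /unit_ball /= => a1; lra.
rewrite d2.
have -> : - n%:R + 2 = - (n - 2)%:R :> R by rewrite natrB 1?ltnW//; ring.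
rewrite powR_invn ?enorm_ge0//.
have g := grad_norm_ray_proj_le_dist (ltnW n3) a1 ta.
have r'0 : 0 <= enorm x ^- (n - 2) by rewrite invr_ge0 exprn_ge0 ?enorm_ge0.
apply: (le_trans (ler_wpM2l r'0 g)).
have d'0 : 0 <= enorm (x - a) ^- 2 by rewrite invr_ge0 exprn_ge0 ?enorm_ge0.
rewrite -/C mulrCA -(mulrA C) -(mulrA C) -mulrDr; apply: ler_wpM2l => //.
have [er|re] := leP e (enorm x).
  apply: ler_wpDl; first by rewrite mulr_ge0// invr_ge0 exprn_ge0// ltW.
  apply: ler_wpM2r => //.
  by rewrite lef_pV2 ?posrE ?exprn_gt0 ?(lt_le_trans e0)//
    lerXn2r ?nnegrE ?enorm_ge0 ?(ltW e0).
have ed : e <= enorm (x - a).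
  have := enorm_triangle x (a - x); rewrite addrC subrK -(enormN (a - x)) opprB.
  by move: re; rewrite /e; lra.
apply: ler_wpDr; first by rewrite mulr_ge0// invr_ge0 exprn_ge0// ltW.
rewrite mulrC; apply: ler_wpM2r => //.
by rewrite lef_pV2 ?posrE ?exprn_gt0 ?(lt_le_trans e0)//
    lerXn2r ?nnegrE ?enorm_ge0 ?(ltW e0).
Qed.

(** It includes the weight [|x|^(4 - n)], that of the end exponent of part (ii). *)
Definition density_bound a t : R :=
  if dist_tuple 0 t < 1 then
    dist_tuple 0 t ^- (n - 4) *
    fob (enorm a ^+ 2) (dist_tuple a t) (dotv a (row_of_tuple t - a))
  else 0.

Lemma nnmeas_density_bound a : (1 < n)%N -> enorm a <= 2^-1 ->
  nnmeas (density_bound a).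
Proof.
move=> n1 a2; split=> [|t]; last first.
  rewrite /density_bound; case: ifP => // _.
  rewrite mulr_ge0 ?first_order_bound_ge0//.
  by rewrite invr_ge0 exprn_ge0 ?dist_tuple_ge0.
apply: measurable_fun_ifT => //.
  by apply: measurable_fun_ltr => //; exact: measurable_dist_tuple.
apply: measurable_funM; first exact: measurable_dist_expVn.
apply: measurable_funM; last exact: measurable_dist_expVn.
apply: measurable_funD => //; apply: measurable_funM => //.
apply: measurable_funB => //; apply: measurable_funM => //.
apply: measurable_funM.
  apply: measurable_sum => i; apply: measurable_funM => //.
  rewrite (_ : (fun _ => _) = fun t => row_of_tuple t 0 i - a 0 i).
    by apply: measurable_funB => //; exact: measurable_coord.
  by apply/funext => t; rewrite !mxE.
exact: (measurable_dist_expVn a 1).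
Qed.

(** Near the origin, for [|x| < 5 delta], the full density is put into the
    error; there [|x - a| < 6 delta]. The second term bounds the errors of
    relative order [delta^2] on the whole ball, where [|x - a| < 2]. *)
Definition error_kernel (delta : R) a t : R :=
  (n%:R - 1) * (sing_kernel 0 (n - 2) (5 * delta) t +
                sing_kernel a (n - 2) (6 * delta) t) +
  6 * n%:R * delta ^+ 2 * (sing_kernel 0 (n - 1) 1 t + sing_kernel a (n - 1) 2 t).

(** The coefficients are [61 = 5^2 + 6^2] and [18 = 6 (1 + 2)], from the radii of
    the kernels in [error_kernel]. *)
Definition error_const : R :=
  61 * (n%:R - 1) * 2 ^+ (n + (n - 2)).+1 + 18 * n%:R * 2 ^+ (n + (n - 1)).+1.

Lemma nnmeas_error_kernel delta a : (0 < n)%N -> nnmeas (error_kernel delta a).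
Proof.
move=> n0; have n1 : 0 <= n%:R - 1 :> R by rewrite subr_ge0 ler1n.
apply: nnmeasD; apply: nnmeasZ => //.
- by apply: nnmeasD; exact: nnmeas_sing_kernel.
- by rewrite mulr_ge0 ?sqr_ge0// mulr_ge0.
- by apply: nnmeasD; exact: nnmeas_sing_kernel.
Qed.

Lemma integral_error_kernel_le delta a : (2 < n)%N -> 0 < delta ->
  (\int[mu]_t (error_kernel delta a t)%:E <= (error_const * delta ^+ 2)%:E)%E.
Proof.
move=> n3 d0; have n0 : (0 < n)%N by exact: ltn_trans n3.
have n2 : (0 < n - 2 < n)%N by rewrite subn_gt0 n3 ltn_subrL.
have n1 : (0 < n - 1 < n)%N by rewrite subn_gt0 ltn_subrL (ltnW n3).
have nR : 0 <= n%:R - 1 :> R by rewrite subr_ge0 ler1n.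
have D0 : 0 <= 6 * n%:R * delta ^+ 2 by rewrite mulr_ge0 ?sqr_ge0// mulr_ge0.
have K := nnmeas_sing_kernel.
rewrite /error_kernel integral_nnmeasD//; try by apply: nnmeasZ => //; exact: nnmeasD.
rewrite !integral_nnmeasZ//; try exact: nnmeasD.
rewrite !integral_nnmeasD//.
have d5 : 0 < 5 * delta by rewrite mulr_gt0.
have d6 : 0 < 6 * delta by rewrite mulr_gt0.
have i1 := integral_sing_kernel_le (0 : 'rV[R]_n) n2 d5.
have i2 := integral_sing_kernel_le a n2 d6.
have i3 := integral_sing_kernel_le (0 : 'rV[R]_n) n1 (ltr01 : 0 < (1 : R)).
have i4 := integral_sing_kernel_le a n1 (ltr0Sn R 1).
apply: le_trans (leeD (lee_wpmul2l _ (leeD i1 i2)) (lee_wpmul2l _ (leeD i3 i4))) _;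
  rewrite ?lee_fin//.
rewrite (subKn (ltnW n3)) (subKn n0) expr1n expr1 /error_const.
by rewrite le_eqVlt; apply/orP; left; apply/eqP; ring.
Qed.

(** Far from the origin this combines the cancellation within the pairs
    [+- delta e_i] with the defect in the mean of [|x|^-2]; near the origin the
    whole left-hand side goes into the error. The products of the weight with
    powers of the distance to [+- delta e_i] are split by [inv_pow_mul_le]. *)
Lemma sum_density_bound_le (delta : R) t : (5 < n)%N -> 0 < delta -> delta <= 5^-1 ->
  \sum_(i < n) (density_bound (delta *: delta_mx 0 i) t +
                density_bound (- (delta *: delta_mx 0 i)) t) +
    (n%:R - 1) * delta ^+ 2 * annulus_kernel (5 * delta) t <=
  2 * n%:R * (n%:R - 1) * sing_kernel 0 (n - 2) 1 t +
  \sum_(i < n) (error_kernel delta (delta *: delta_mx 0 i) t +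
                error_kernel delta (- (delta *: delta_mx 0 i)) t).
Proof.
move=> n6 d0 d5; have n0 : (0 < n)%N by exact: ltn_trans n6.
have nR : 6 <= n%:R :> R by rewrite ler_nat.
have n1 : 0 <= n%:R - 1 :> R by lra.
have E0 i : 0 <= error_kernel delta (delta *: delta_mx 0 i) t +
                error_kernel delta (- (delta *: delta_mx 0 i)) t.
  by rewrite addr_ge0//; apply: (nnmeas_error_kernel _ _ n0).2.
have nn0 : 0 <= 2 * n%:R * (n%:R - 1) :> R by rewrite !mulr_ge0.
rewrite /density_bound /annulus_kernel /(sing_kernel 0 (n - 2) 1).
have [t1|_] := ltP (dist_tuple 0 t) 1; last first.
  rewrite andbF !mulr0 !addr0 add0r big1 => [|i _]; last by [].

  by apply: sumr_ge0 => i _; exact: E0.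
rewrite andbT dist_tuple0; rewrite dist_tuple0 in t1.
set x := row_of_tuple t in t1 *; set r := enorm x in t1 *.
pose a i : 'rV[R]_n := delta *: delta_mx 0 i.
pose d i := enorm (x - a i); pose e i := enorm (x + a i).
have r0 : 0 <= r by exact: enorm_ge0.
have V0 z m : 0 <= z -> 0 <= z ^- m :> R by move=> z0; rewrite invr_ge0 exprn_ge0.
have dr i : d i <= r + delta.
  by rewrite (le_trans (enorm_triangle _ _))// enormN enorm_delta// ltW.
have er i : e i <= r + delta.
  by rewrite (le_trans (enorm_triangle _ _))// enorm_delta// ltW.
have di0 i : 0 <= d i by exact: enorm_ge0.
have ei0 i : 0 <= e i by exact: enorm_ge0.
pose W := r ^- (n - 4).
have W0 : 0 <= W by exact: V0.
have n40 : (0 < n - 4)%N by lia.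
have n43 : (n - 4 + 3 = n - 1)%N by lia.
have n42 : (n - 4 + 2 = n - 2)%N by lia.
have n44 : (n - 4 + 4 = n)%N by lia.
have W3 z : 0 <= z -> W * z ^- 3 <= r ^- (n - 1) + z ^- (n - 1).
  by move=> z0; rewrite -n43; exact: inv_pow_mul_le.
have W2 z : 0 <= z -> W * z ^- 2 <= r ^- (n - 2) + z ^- (n - 2).
  by move=> z0; rewrite -n42; exact: inv_pow_mul_le.
have dens i :
    W * fob (enorm (a i) ^+ 2) (dist_tuple (a i) t) (dotv (a i) (x - a i)) +
    W * fob (enorm (- a i) ^+ 2) (dist_tuple (- a i) t) (dotv (- a i) (x - - a i)) <=
    (n%:R - 1) * (W * (d i ^- 2 + e i ^- 2)) +
    6 * n%:R * delta ^+ 2 * (W * (d i ^- 3 + e i ^- 3)).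
  rewrite -mulrDr /dist_tuple -/x enormN opprK.
  apply: (@le_trans _ _ (W * ((n%:R - 1) * (d i ^- 2 + e i ^- 2) +
     6 * n%:R * delta ^+ 2 * (d i ^- 3 + e i ^- 3)))); last first.
    by rewrite le_eqVlt; apply/orP; left; apply/eqP; ring.
  apply: ler_wpM2l => //.
  have := @first_order_bound_pair R n (a i) x n0.
  rewrite enorm_delta ?(ltW d0)// -/(d i) -/(e i); apply.
    by have := dr i; lra.
  by have := er i; lra.
have err3 i : 6 * n%:R * delta ^+ 2 * (W * (d i ^- 3 + e i ^- 3)) <=
    6 * n%:R * delta ^+ 2 *
      ((r ^- (n - 1) + d i ^- (n - 1)) + (r ^- (n - 1) + e i ^- (n - 1))).
  apply: ler_wpM2l; first by rewrite mulr_ge0 ?sqr_ge0// mulr_ge0.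
  by rewrite mulrDr lerD ?W3.
have errE i : error_kernel delta (a i) t + error_kernel delta (- a i) t =
   (n%:R - 1) *
     ((sing_kernel 0 (n - 2) (5 * delta) t +
       sing_kernel (a i) (n - 2) (6 * delta) t) +
      (sing_kernel 0 (n - 2) (5 * delta) t +
       sing_kernel (- a i) (n - 2) (6 * delta) t)) +
   6 * n%:R * delta ^+ 2 *
      ((r ^- (n - 1) + d i ^- (n - 1)) + (r ^- (n - 1) + e i ^- (n - 1))).
  have s1 : sing_kernel 0 (n - 1) 1 t = r ^- (n - 1).
    by rewrite /sing_kernel dist_tuple0 -/x t1.
  have s2 : sing_kernel (a i) (n - 1) 2 t = d i ^- (n - 1).
    by rewrite /sing_kernel /dist_tuple -/x ifT// -/(d i); have := dr i; lra.
  have s3 : sing_kernel (- a i) (n - 1) 2 t = e i ^- (n - 1).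
    by rewrite /sing_kernel /dist_tuple -/x opprK ifT// -/(e i); have := er i; lra.
  by rewrite /error_kernel s1 s2 s3; ring.
have [near|far] := ltP r (5 * delta).
  rewrite mulr0 addr0 -[leLHS]add0r; apply: lerD.
    by rewrite mulr_ge0// V0.
  apply: ler_sum => i _; apply: le_trans (dens i) _.
  rewrite errE; apply: lerD => //; apply: ler_wpM2l => //.
  rewrite mulrDr /sing_kernel dist_tuple0 -/x -/r near /dist_tuple -/x opprK.
  rewrite -/(d i) -/(e i) !ifT; first by rewrite lerD ?W2.
    by have := er i; lra.
  by have := dr i; lra.
have mean : (n%:R - 1) * (W * \sum_(i < n) (d i ^- 2 + e i ^- 2)) <=
   2 * n%:R * (n%:R - 1) * r ^- (n - 2) - (n%:R - 1) * delta ^+ 2 * r ^- n.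
  have h := ler_wpM2l n1 (ler_wpM2l W0 (sum_inv_sqr_shift n6 d0 far)).
  apply: (le_trans h).
  have -> : r ^- (n - 2) = W * r ^- 2 by rewrite -n42 exprD invfM.
  have -> : r ^- n = W * r ^- 4 by rewrite -[in LHS]n44 exprD invfM.
  by rewrite le_eqVlt; apply/orP; left; apply/eqP; rewrite -/r; ring.
apply: (@le_trans _ _ (\sum_(i < n) ((n%:R - 1) * (W * (d i ^- 2 + e i ^- 2)) +
   6 * n%:R * delta ^+ 2 *
      ((r ^- (n - 1) + d i ^- (n - 1)) + (r ^- (n - 1) + e i ^- (n - 1))))
    + (n%:R - 1) * delta ^+ 2 * r ^- n)).
  rewrite lerD2r; apply: ler_sum => i _; apply: (le_trans (dens i)).
  by rewrite lerD2l.
rewrite big_split /= -!mulr_sumr.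
have err_le : 6 * n%:R * delta ^+ 2 *
    (\sum_(i < n) ((r ^- (n - 1) + d i ^- (n - 1)) +
                   (r ^- (n - 1) + e i ^- (n - 1)))) <=
    \sum_(i < n) (error_kernel delta (a i) t + error_kernel delta (- a i) t).
  rewrite mulr_sumr; apply: ler_sum => i _; rewrite errE lerDr.
  by rewrite mulr_ge0// !addr_ge0// sing_kernel_ge0.
rewrite -/a; lra.
Qed.

End Comparison.

Section Improvement.
Context {R : realType} {n : nat}.
Implicit Types (a : 'rV[R]_n) (t : n.-tuple (measurableTypeR R)).

Local Notation mu := (lebesgue_measure_tuple R n).
Local Notation energy a := (weighted_energy (4 - n%:R) (ray_proj (a : 'rV[R]_n))).

Lemma error_const_gt0 : (1 < n)%N -> 0 < @error_const R n.
Proof.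
move=> n1; have nR : 2 <= n%:R :> R by rewrite ler_nat.
by apply: addr_gt0; do ![apply: mulr_gt0 => //|exact: exprn_gt0]; lra.
Qed.

Lemma weighted_energy_center4 : (5 < n)%N ->
  energy 0 = ((n%:R - 1)%:E * \int[mu]_t (sing_kernel 0 (n - 2) 1 t)%:E)%E.
Proof.
move=> n6; have n0 : (0 < n)%N by exact: ltn_trans n6.
have nR : 6 <= n%:R :> R by rewrite ler_nat.
rewrite weighted_energy_center//; last by lra.
congr (_ * _)%E; apply: eq_integral => t _; rewrite /ball_powR /sing_kernel.
have -> : 4 - n%:R - 2 = - (n - 2)%:R :> R by rewrite natrB; [ring|lia].
by rewrite powR_invn ?dist_tuple_ge0.
Qed.

Lemma weighted_energy_le_density_bound a : (5 < n)%N -> enorm a <= 2^-1 ->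
  (energy a <= \int[mu]_t (density_bound a t)%:E)%E.
Proof.
move=> n6 a2; apply: weighted_energy_le; first by lia.
  by apply: nnmeas_density_bound => //; lia.
move=> t t1 ta; rewrite /density_bound dist_tuple0 t1.
have -> : 4 - n%:R = - (n - 4)%:R :> R by rewrite natrB; [ring|lia].
rewrite powR_invn ?enorm_ge0//; apply: ler_wpM2l.
  by rewrite invr_ge0 exprn_ge0 ?enorm_ge0.
by apply: grad_norm_ray_proj_first_order => //; lia.
Qed.

(** If no [a] did better than 0, then summing over [+- delta e_i] and
    integrating the pointwise comparison would bound
    [(n - 1) \int |x|^-n] over the annulus [5 delta <= |x| < 1] by a constant
    independent of [delta]. *)
Lemma exists_lower_energy : (5 < n)%N ->
  exists2 a, unit_ball a & (energy a < energy 0)%E.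
Proof.
move=> n6; have n0 : (0 < n)%N by exact: ltn_trans n6.
have n1 : (1 < n)%N by exact: ltn_trans n6.
have n3 : (2 < n)%N by exact: ltn_trans n6.
have nR : 6 <= n%:R :> R by rewrite ler_nat.
apply: contrapT => noa.
have c0 := error_const_gt0 n1; set c := error_const in c0.
have [rho /andP[rho0 rho1] annulus_ge] :=
  integral_annulus_kernel_unbounded (2 * n%:R * c : R) n0.
pose delta := rho / 5.
have d0 : 0 < delta by rewrite divr_gt0.
have d5 : delta <= 5^-1 by rewrite ler_piMl.
have rhoE : 5 * delta = rho by rewrite /delta; field.
pose a i : 'rV[R]_n := delta *: delta_mx 0 i.
have an i : enorm (a i) <= 2^-1 by rewrite enorm_delta ?(ltW d0)//; lra.
have aNn i : enorm (- a i) <= 2^-1 by rewrite enormN.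
have le0 b : enorm b <= 2^-1 -> (energy 0 <= \int[mu]_t (density_bound b t)%:E)%E.
  move=> b2; apply: le_trans (weighted_energy_le_density_bound n6 b2).
  rewrite leNgt; apply/negP => lt0; apply: noa; exists b => //.
  by rewrite /unit_ball /=; lra.
have nn1 : 0 <= n%:R - 1 :> R by lra.
have K := @nnmeas_sing_kernel R n.
have n2 : (0 < n - 2 < n)%N by lia.
pose V := fine (\int[mu]_t (sing_kernel 0 (n - 2) 1 t)%:E)%E.
have VE : (\int[mu]_t (sing_kernel 0 (n - 2) 1 t)%:E = V%:E)%E.
  rewrite /V fineK// ge0_fin_numE; last first.
    by apply: integral_ge0 => t _; rewrite lee_fin sing_kernel_ge0.
  exact: le_lt_trans (integral_sing_kernel_le _ n2 ltr01) (ltry _).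
have E0 : energy 0 = ((n%:R - 1) * V)%:E by rewrite weighted_energy_center4// VE EFinM.
have Zd i : nnmeas (fun t => density_bound (a i) t + density_bound (- a i) t).
  by apply: nnmeasD; exact: nnmeas_density_bound.
have Ze i : nnmeas (fun t => error_kernel delta (a i) t + error_kernel delta (- a i) t).
  by apply: nnmeasD; exact: nnmeas_error_kernel.
have Zsd := nnmeas_sum Zd; have Zse := nnmeas_sum Ze.
have D0 : 0 <= (n%:R - 1) * delta ^+ 2 by rewrite mulr_ge0 ?sqr_ge0.
have N0 : 0 <= 2 * n%:R * (n%:R - 1) :> R by rewrite !mulr_ge0.
have Za := nnmeasZ D0 (@nnmeas_annulus_kernel R n (5 * delta)).
have Zk := nnmeasZ N0 (K 0 (n - 2)%N 1).
have := le_integral_nnmeas mu (nnmeasD Zsd Za) (nnmeasD Zk Zse)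
  (fun t => sum_density_bound_le t n6 d0 d5).
rewrite !integral_nnmeasD// !integral_nnmeas_sum// !integral_nnmeasZ//;
  try exact: nnmeas_annulus_kernel.
rewrite VE rhoE.
have lower : ((\sum_(i < n) ((n%:R - 1) * V + (n%:R - 1) * V))%:E <=
    \sum_(i < n) \int[mu]_t (density_bound (a i) t + density_bound (- a i) t)%:E)%E.
  rewrite -sumEFin; apply: lee_sum => i _.
  rewrite integral_nnmeasD; try exact: nnmeas_density_bound.
  by rewrite EFinD -E0 leeD// le0.
have upper : (\sum_(i < n) \int[mu]_t (error_kernel delta (a i) t +
     error_kernel delta (- a i) t)%:E <=
   (\sum_(i < n) (c * delta ^+ 2 + c * delta ^+ 2))%:E)%E.
  rewrite -sumEFin; apply: lee_sum => i _.
  rewrite integral_nnmeasD; try exact: nnmeas_error_kernel.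
  rewrite EFinD; apply: leeD; exact: integral_error_kernel_le.
have scaled := lee_wpmul2l (_ : (0 <= ((n%:R - 1) * delta ^+ 2)%:E)%E) annulus_ge.
move=> h.
have := le_trans (leeD lower (scaled _)) (le_trans h (leeD (lexx _) upper)).
rewrite lee_fin => /(_ D0); rewrite lee_fin.
rewrite !sumr_const card_ord -(mulr_natl (_ * V + _)) -(mulr_natl (c * _ + _)).
have D1 : 0 < delta ^+ 2 by exact: exprn_gt0.
have nc : 0 < n%:R * c * delta ^+ 2 by rewrite !mulr_gt0//; lra.
move=> final.
have : (n%:R - 1) * (2 * (n%:R * c * delta ^+ 2)) <= 2 * (n%:R * c * delta ^+ 2).
  move: final; lra.
nra.
Qed.

End Improvement.

Theorem theorem0p3 (R : realType) (n : nat) (hn : (3 <= n)%N) :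
  (forall a : 'rV[R]_n, unit_ball a -> a != 0 ->
     exists alpha0 : R, [/\ - n%:R + 2 < alpha0, alpha0 < 0 &
       forall alpha : R, - n%:R + 2 < alpha -> alpha <= alpha0 ->
         (weighted_energy alpha (ray_proj (0 : 'rV[R]_n)) >
            weighted_energy alpha (ray_proj a))%E])
  /\
  ((6 <= n)%N ->
     exists alpha0 : R, [/\ 4 - n%:R < alpha0, alpha0 < 5 - n%:R &
       forall alpha : R, 4 - n%:R < alpha -> alpha < alpha0 ->
         exists a : 'rV[R]_n, unit_ball a /\
           (weighted_energy alpha (ray_proj (0 : 'rV[R]_n)) >
            weighted_energy alpha (ray_proj a))%E]).
Proof.
have n0 : (0 < n)%N by exact: ltn_trans hn.
have nR : 3 <= n%:R :> R by rewrite ler_nat.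
split => [a a1 a0|n6].
  have bg : - n%:R + 2 < 0 :> R by lra.
  have lt0 : (weighted_energy (- n%:R + 2) (ray_proj a) <
      weighted_energy (- n%:R + 2) (ray_proj (0 : 'rV[R]_n)))%E.
    by rewrite weighted_energy_center_critical// weighted_energy_critical_fin.
  have [alpha0 /andP[b0 g0] H] := weighted_energy_center_lsc n0 bg (lexx 0) lt0.
  exists alpha0; split=> [||alpha ba aa0]; [exact: b0|exact: g0|].
  apply: le_lt_trans (H _ ba aa0).
  by apply: weighted_energy_nonincreasing; [exact: ltW|exact: le_lt_trans g0].
have nR6 : 6 <= n%:R :> R by rewrite ler_nat.
have [a a1 lt0] := @exists_lower_energy R n n6.
have bg : 4 - n%:R < 5 - n%:R :> R by lra.
have g0 : 5 - n%:R <= 0 :> R by lra.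
have [alpha0 /andP[b0 ag] H] := weighted_energy_center_lsc n0 bg g0 lt0.
exists alpha0; split=> [||alpha ba aa0]; [exact: b0|exact: ag|].
exists a; split; first exact: a1.
apply: le_lt_trans (H _ ba (ltW aa0)).
by apply: weighted_energy_nonincreasing; [exact: ltW|lra].
Qed.
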